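(* Let $(X,\mathbb{Z})$ be a minimal dynamical system on a compact metric space $X$ with $\operatorname{mdim} X = d$ and let $k>d$ be a natural number. Then for almost every continuous map $f : X \to [0,1]^k$, every fiber of the induced map $f^{\mathbb{Z}} : X \to ([0,1]^k)^{\mathbb{Z}}$, $f^{\mathbb{Z}}(x) = (f(x+z))_{z\in\mathbb{Z}}$, contains at most $\left[\frac{k}{k-d}\right]\frac{k}{k-d}$ points.
   Context: A dynamical system $(X,\mathbb{Z})$ is an action of $\mathbb{Z}$ on $X$ by homeomorphisms; the action of $z\in\mathbb{Z}$ on $x\in X$ is written $x+z$. It is minimal if every orbit is dense. $[t]$ denotes the integer part of the real number $t$. The map $f^{\mathbb{Z}}$ is equivariant with respect to the shift action on $([0,1]^k)^{\mathbb{Z}}$. A fiber is the preimage of a point. ''Almost every map'' is meant in the Baire category sense: the set of maps with the stated property contains a dense $G_\delta$ subset of the space $C(X,[0,1]^k)$ of continuous maps with the uniform metric. Mean dimension: for a collection $\mathcal{A}$ of subsets of $X$ and $z\in\mathbb{Z}$ let $\mathcal{A}+z=\{A+z : A\in\mathcal{A}\}$, where $A+z=\{x+z : x\in A\}$; $\operatorname{mesh}\mathcal{A}$ is the supremum of the diameters of the elements of $\mathcal{A}$; $\operatorname{ord}\mathcal{A}$ is the maximal number of elements of $\mathcal{A}$ having a common point. For a real number $d>0$ write $\operatorname{mdim}X\le d^-$ if for every $\epsilon>0$ there is a finite closed cover $\mathcal{A}$ of $X$ such that $\operatorname{mesh}(\mathcal{A}+z)<\epsilon$ for every integer $z$ satisfying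 $0\le zd<\operatorname{ord}\mathcal{A}$. Then $\operatorname{mdim}X=\inf\{d>0 : \operatorname{mdim}X\le d^-\}$, with $\operatorname{mdim}X=\infty$ if this set is empty. This coincides with Gromov's mean dimension of $(X,\mathbb{Z})$. *)

(* Defs.v *)
From HB Require Import structures.
From mathcomp Require Import all_boot all_order all_algebra finmap.
From mathcomp Require Import all_classical all_reals all_analysis borel_hierarchy.
Set Implicit Arguments.
Unset Strict Implicit.
Unset Printing Implicit Defensive.
Import Order.TTheory GRing.Theory Num.Theory.
Import numFieldNormedType.Exports.

Local Open Scope classical_set_scope.
Local Open Scope ring_scope.

(* [int_act x z] is the point written x + z. Each [int_act^~ z] is a homeomorphism,
   with inverse [int_act^~ (- z)]. *)
Record int_action (X : topologicalType) := IntAction {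
  int_act :> X -> int -> X;
  int_act0 : forall x, int_act x 0 = x;
  int_actD : forall x m n, int_act x (m + n) = int_act (int_act x m) n;
  int_act_continuous : forall z, continuous (int_act^~ z) }.

Definition minimal (X : topologicalType) (T : int_action X) : Prop :=
  forall x : X, dense (range (T x)).

Section MeanDimension.
Context {R : realType} {X : metricType R}.
Implicit Types (T : int_action X) (A : {fset set X}).

(* Adding 0 to the set of distances only makes the diameter of the empty set
   0 instead of -oo; likewise for the mesh of the empty collection. *)
Definition diameter (S : set X) : \bar R :=
  ereal_sup (0%E |` [set (mdist x y)%:E | x in S & y in S]).

Definition mesh A : \bar R :=
  ereal_sup (0%E |` [set diameter a | a in [set` A]]).

Definition cover_ord A : nat :=
  \max_(B <- fpowerset A | `[< \bigcap_(b in [set` B]) b !=set0 >])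
     #|` B|.

Definition translate T A (z : int) : {fset set X} :=
  [fset [set T x z | x in a] | a in A]%fset.

Definition finite_closed_cover A : Prop :=
  (forall a, a \in A -> closed a) /\ \bigcup_(a in [set` A]) a = [set: X].

(* mdim X <= d^- *)
Definition mdim_le_minus T (d : R) : Prop :=
  forall eps : R, 0 < eps ->
    exists2 A, finite_closed_cover A &
      forall z : int, 0 <= z%:~R * d < (cover_ord A)%:R ->
        (mesh (translate T A z) < eps%:E)%E.

Definition mdim T : \bar R :=
  ereal_inf [set d%:E | d in [set d : R | 0 < d /\ mdim_le_minus T d]].

End MeanDimension.

Definition cube (R : realType) (k : nat) : set 'rV[R]_k :=
  [set v | forall i, 0 <= v ord0 i <= 1].
Arguments cube : clear implicits.

(* The space C(X, Y) with the topology of uniform convergence; its ball of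
   radius e around f is the set of g with [ball (f x) e (g x)] for all x. *)
Definition cfun_space (X : topologicalType) (Y : uniformType) :=
  initial_topology
    (fun f : continuousType X Y => (f : arrow_uniform_type X Y)).

Definition almost_every (M : topologicalType) (P : set M) : Prop :=
  exists2 G : set M, Gdelta G /\ dense G & G `<=` P.

Definition orbit_map (X : topologicalType) (T : int_action X) (Y : Type)
  (f : X -> Y) : X -> (int -> Y) := fun x z => f (T x z).

Definition at_most (R : realType) (X : choiceType) (S : set X) (r : R) : Prop :=
  finite_set S /\ #|` fset_set S|%:R <= r.

(* Main.v *)
(* The bound proved is a^2 with a = [k / (k - d)]. Fix d' > d with (a + 1)(k - d') > k, and
   write A for a finite closed cover of order at most d' n whose translates by 0, ..., n - 1
   have small mesh. If X is infinite, the action is free, and there is a closed tower: a set C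
   whose translates by 0, ..., n - 1 are disjoint and miss only a small density of times along
   each orbit. It comes from a one-dimensional power diagram: a time z on the orbit of x is led
   by the integer t that maximizes psi(x + t) - (z - t)^2, where psi is a large bump function
   around a point, and C consists of the blocks aligned with the leader.
   Each of the k n coordinates of a block reads bits of the position in A, obtained by
   thresholding the functions of a partition-like family subordinate to A. With different
   thresholds for different coordinates, each function leaves at most one coordinate undecided,
   so at most d' n of the k n coordinates are undecided. A perturbation g of the given map takes
   on decided coordinates values that determine the phase in the block and the bits; a much
   smaller additive term encodes in the same way, for all times in a long window, the phase of
   the tower or, outside of the tower, a small set containing the point.
   Let points with equal images be pairwise far apart. If they have the same phase at time 0, no
   two of them can be decided at the same coordinate of the block, so counting coordinates there
   are at most a of them. If they have pairwise different phases (or lie outside of the tower),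
   no two of them can be decided at the same coordinate of the long window, so again there are
   at most a. *)

Require Import Defs.
From HB Require Import structures.
From mathcomp Require Import all_boot all_order all_algebra finmap.
From mathcomp Require Import all_classical all_reals all_analysis borel_hierarchy.
From mathcomp Require Import zify ring lra.
Import Order.TTheory GRing.Theory Num.Theory.
Import numFieldNormedType.Exports.
Local Open Scope classical_set_scope.
Local Open Scope ring_scope.
Set Implicit Arguments.
Unset Strict Implicit.
Unset Printing Implicit Defensive.

(** * Covers of small order from mean dimension *)

Section Continuity.
Context {R : realType} {T : topologicalType}.
Implicit Types h : T -> R.

Lemma continuous_sum (I : Type) (r : seq I) (P : pred I) (h : I -> T -> R) :
  (forall i, continuous (h i)) -> continuous (fun x => \sum_(i <- r | P i) h i x).
Proof.
move=> hc; elim: r => [|i r IH] x.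
  by under eq_fun do rewrite big_nil; exact: cvg_cst.
under eq_fun do rewrite big_cons.
by case: (P i); [apply: continuousD; [exact: hc|exact: IH]|exact: IH].
Qed.

Lemma continuous_prod (I : Type) (r : seq I) (P : pred I) (h : I -> T -> R) :
  (forall i, continuous (h i)) -> continuous (fun x => \prod_(i <- r | P i) h i x).
Proof.
move=> hc; elim: r => [|i r IH] x.
  by under eq_fun do rewrite big_nil; exact: cvg_cst.
under eq_fun do rewrite big_cons.
by case: (P i); [apply: continuousM; [exact: hc|exact: IH]|exact: IH].
Qed.

Lemma continuous_minr h1 h2 : continuous h1 -> continuous h2 ->
  continuous (fun x => Num.min (h1 x) (h2 x)).
Proof. by move=> c1 c2 x; apply: (@continuous_min R T h1 h2 x); [exact: c1|exact: c2]. Qed.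

Lemma continuous_maxr h1 h2 : continuous h1 -> continuous h2 ->
  continuous (fun x => Num.max (h1 x) (h2 x)).
Proof. by move=> c1 c2 x; apply: (@continuous_max R T h1 h2 x); [exact: c1|exact: c2]. Qed.

End Continuity.
Lemma continuous_mdistP {R : realType} {X : metricType R} (h : X -> R) :
  continuous h <-> forall x e, 0 < e ->
     exists2 d, 0 < d & forall y, mdist x y < d -> `|h x - h y| < e.
Proof.
split=> [hc x e e0|hc x].
  have /cvgrPdist_lt/(_ e e0) := hc x.
  move=> /metricType_numDomainType.nbhs_mdistP [d /= d0 dh].
  by exists d => // y /dh.
apply/cvgrPdist_lt => e e0; have [d d0 dh] := hc x e e0.
apply/metricType_numDomainType.nbhs_mdistP; exists d => //=.
Qed.

(** Compactness in its near-covering form, for the filter generated by inclusion of finite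
    sequences: near [x] it suffices that the sequence contains [x]. *)
Lemma compact_finite_balls {R : realType} {X : metricType R} (r : X -> R) :
  compact [set: X] -> (forall x, 0 < r x) ->
  exists s : seq X, forall x, exists2 c, c \in s & mdist c x < r c.
Proof.
move=> /compact_near_coveringP cX r0.
pose F : set_system (seq X) :=
  [set A : set (seq X) | exists s0 : seq X, forall s : seq X, {subset s0 <= s} -> A s].
have FF : Filter F.
  split; first by exists [::].
    move=> P Q [s sP] [t tQ]; exists (s ++ t) => u su.
    split; [apply: sP => x xs|apply: tQ => x xs]; apply: su; rewrite mem_cat xs//.
    by rewrite orbT.
  by move=> P Q PQ [s sP]; exists s => u /sP /PQ.
have : \near F, [set: X] `<=` (fun x => exists2 c, c \in F & mdist c x < r c).
  apply: (cX _ _ (fun (s : seq X) x => exists2 c, c \in s & mdist c x < r c)) => x _.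
  exists ([set y | mdist x y < r x], [set s : seq X | x \in s]) => /=.
    split; last by exists [:: x] => s /(_ x); rewrite inE eqxx; exact.
    by apply/metricType_numDomainType.nbhs_mdistP; exists (r x) => //=.
  by move=> [y s] /= [xy xs]; exists x.
case=> s0 /(_ s0 (fun x h => h)) h; exists s0 => x; exact: h.
Qed.

(** The least radius of a finite subcover serves as [rho]. With halved radii as input, the
    [rho]-ball around [x] stays in the full ball around [c]. *)
Lemma lebesgue_number {R : realType} {X : metricType R} (r : X -> R) :
  compact [set: X] -> (forall x, 0 < r x) ->
  exists2 rho, 0 < rho & forall x, exists2 c, mdist c x < r c & rho <= r c.
Proof.
move=> cX r0; have [s hs] := compact_finite_balls cX r0.
exists (\big[Num.min/1]_(c <- s) r c).
  by elim/big_ind: _ => // x y x0 y0; rewrite lt_min x0.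
move=> x; have [c cs cx] := hs x; exists c => //.
elim: s cs {hs} => // a s IH; rewrite inE big_cons ge_min => /orP[/eqP<-|/IH->].
  by rewrite lexx.
by rewrite orbT.
Qed.

(** The supremum of [1 - mdist x y / rho] over [y] in [a], cut off at 0, is Lipschitz with constant
    [1 / rho]; the inserted 0 also covers empty [a]. *)
Lemma set_bump {R : realType} {X : metricType R} (a : set X) (rho : R) :
  0 < rho -> exists w : X -> R,
    [/\ continuous w, forall x, 0 <= w x <= 1, forall x, a x -> w x = 1 &
        forall x, 0 < w x -> exists2 y, a y & mdist x y < rho].
Proof.
move=> rho0.
pose B x := 0 |` [set 1 - mdist x y / rho | y in a].
have B0 x : B x 0 by left.
have ub1 x : ubound (B x) 1.
  move=> _ [->|[y _ <-]]; first exact: ler01.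
  by rewrite gerBl divr_ge0 ?mdist_ge0 ?ltW.
have hs x : has_sup (B x) by split; [exists 0|exists 1].
pose w x := sup (B x).
have Bw x t : B x t -> t <= w x by move=> Bt; exact: (ub_le_sup (hs x).2).
have wle x t : ubound (B x) t -> w x <= t.
  by move=> ubt; apply: ge_sup => //; exists 0.
have lip x x' : w x <= w x' + mdist x x' / rho.
  apply: wle => _ [->|[y ay <-]].
    by apply: addr_ge0; [exact: Bw|rewrite divr_ge0 ?mdist_ge0 ?ltW].
  have := Bw x' _ (or_intror (ex_intro2 _ _ y ay erefl)).
  have : (mdist x' y) / rho <= (mdist x x' + mdist x y) / rho.
    by rewrite ler_pM2r ?invr_gt0// (metric_sym x x') metric_triangle.
  lra.
exists w; split.
- apply/continuous_mdistP => x e e0; exists (e * rho); first exact: mulr_gt0.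
  move=> y; rewrite -ltr_pdivrMr// => xy.
  have := lip x y; have := lip y x; rewrite (metric_sym y x) ltr_norml => ? ?.
  by apply/andP; split; lra.
- by move=> x; rewrite wle// Bw.
- move=> x ax; apply/eqP; rewrite eq_le wle//= Bw//; right; exists x => //.
  by rewrite mdistxx mul0r subr0.
move=> x wx0; apply: contrapT => h; suff : w x <= 0 by rewrite leNgt wx0.
apply: wle => _ [->//|[y ay <-]]; rewrite subr_le0 ler_pdivlMr// mul1r leNgt.
by apply/negP => xy; apply: h; exists y.
Qed.

Section Cover.
Context {R : realType} {X : metricType R} (T : int_action X).
Hypothesis cX : compact [set: X].

Lemma action_equicontinuous (n : nat) (e : R) : 0 < e ->
  exists r : X -> R, (forall x, 0 < r x) /\
    forall x y i, (i < n)%N -> mdist x y < r x ->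
      mdist (T x i%:Z) (T y i%:Z) < e.
Proof.
move=> e0; suff : forall x, exists r : R, 0 < r /\ forall y i, (i < n)%N ->
    mdist x y < r -> mdist (T x i%:Z) (T y i%:Z) < e.
  move=> /choice[r hr]; exists r; split=> [x|x y i]; first by case: (hr x).
  by case: (hr x) => _; exact.
move=> x; elim: n => [|n [r [r0 hr]]]; first by exists 1.
have /metricType_numDomainType.cvgrPdist_lt/(_ e e0)
  /metricType_numDomainType.nbhs_mdistP [r' /= r'0 hr'] := (@int_act_continuous _ T n%:Z x).
exists (Num.min r r'); split=> [|y i]; first by rewrite lt_min r0.
rewrite ltnS leq_eqVlt lt_min => /orP[/eqP->|ltin] /andP[xr xr'].
  exact: hr'.
exact: hr.
Qed.

Lemma ge_cover_ord (A : {fset set X}) (x : X) :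
  (#|` [fset a in A | `[< (a : set X) x >]]%fset| <= cover_ord A)%N.
Proof.
apply: (@leq_bigmax_seq _ _ _ (fun B : {fset set X} => #|` B|)).
  by rewrite fpowersetE; apply/fsubsetP => a; rewrite !inE => /andP[].
by apply/asboolP; exists x => a /=; rewrite !inE => /andP[_ /asboolP].
Qed.

Lemma mesh_translate_lt (A : {fset set X}) z (e : R) (a : set X) x y :
  (mesh (translate T A z) < e%:E)%E -> a \in A -> a x -> a y ->
  mdist (T x z) (T y z) < e.
Proof.
move=> me aA ax ay; rewrite -lte_fin; apply: le_lt_trans me.
apply: (@le_trans _ _ (diameter [set T x z | x in a])).
  apply: ereal_sup_ubound; right; exists (T x z); first by exists x.
  by exists (T y z) => //; exists y.
apply: ereal_sup_ubound; right; exists [set T x z | x in a] => //=.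
by apply/imfsetP; exists a.
Qed.

(** The functions are bumps around the members of a closed cover, so narrow that all members whose
    bumps are positive at [x] share one point near [x]; hence the order of the cover bounds their
    number. *)
Lemma mdim_cover_functions (d eta : R) (x0 : X) : 0 < d -> mdim_le_minus T d ->
  0 < eta -> exists (A : finType) (n : nat) (w : A -> X -> R),
  [/\ (0 < n)%N, forall a, continuous (w a), forall a x, 0 <= w a x <= 1,
      forall x, exists a, w a x = 1 &
      (forall x, #|[set a | 0 < w a x]%SET|%:R <= d * n%:R) /\
      forall a x y i, 0 < w a x -> 0 < w a y -> (i < n)%N ->
        mdist (T x i%:Z) (T y i%:Z) < eta].
Proof.
move=> d0 hd eta0.
have e0 : 0 < eta / 5 by rewrite divr_gt0.
have [A [clA cvA] meshA] := hd _ e0.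
pose m := cover_ord A.
(* Rounding up gives both [m <= d * n] and [i * d < m] for [i < n], the times at which the mesh is
   controlled. *)
pose n := `|Num.ceil (m%:R / d)|%N.
have c0 : 0 <= Num.ceil (m%:R / d).
  by rewrite ceil_ge0; apply: (@lt_le_trans _ _ 0) => //; rewrite divr_ge0// ltW.
have nE : n%:R = (Num.ceil (m%:R / d))%:~R :> R.
  by rewrite -[in RHS](gez0_abs c0).
have mdn : m%:R <= d * n%:R by rewrite nE mulrC -ler_pdivrMr// ceil_ge.
have small i : (i < n)%N -> i%:R * d < m%:R.
  move=> lt_in; rewrite -ltr_pdivlMr//; have := ceilB1_lt (m%:R / d).
  rewrite intrB -nE; move: lt_in; rewrite -(ler_nat R) -natr1; lra.
have [r [r0 hr]] := action_equicontinuous n e0.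
have sep x : exists s : R, 0 < s /\ forall a, a \in A -> ~ a x ->
    forall y, a y -> s <= mdist x y.
  have : forall s : seq (set X), {subset s <= A} -> exists t : R, 0 < t /\
    forall a, a \in s -> ~ a x -> forall y, a y -> t <= mdist x y.
    elim=> [|a s IH] sA; first by exists 1.
    have [|t [t0 ht]] := IH; first by move=> b bs; apply: sA; rewrite inE bs orbT.
    have [ax|nax] := pselect (a x).
      exists t; split=> // b; rewrite inE => /orP[/eqP->//|]; exact: ht.
    have : nbhs x (~` a).
      apply: open_nbhs_nbhs; split=> //; apply: closed_openC; apply: clA.
      by apply: sA; rewrite inE eqxx.
    move=> /metricType_numDomainType.nbhs_mdistP [t' /= t'0 ht'].
    exists (Num.min t t'); split; first by rewrite lt_min t0.
    move=> b; rewrite inE => /orP[/eqP-> _|bs nbx] y yb; rewrite ge_min.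
      by apply/orP; right; rewrite leNgt; apply/negP => /ht'.
    by rewrite (ht b).
  by move=> /(_ (enum_fset A) (fun _ h => h)).
have [s hs] := choice sep.
(* After halving, a step of length [rho] from [x] stays within [r c] and [s c] of [c]; a member met
   closer than [s c] contains [c]. *)
pose r' x := Num.min (r x) (s x) / 2.
have r'0 x : 0 < r' x by rewrite divr_gt0// lt_min r0 (hs x).1.
have [rho rho0 hrho] := lebesgue_number cX r'0.
have [w hw] := choice (fun a : A => set_bump (val a) rho0).
exists A, n, w; split.
- have [a aA ax] : (\bigcup_(a in [set` A]) a) x0 by rewrite cvA.
  have : (0 < m)%N.
    apply: leq_trans (ge_cover_ord A x0); rewrite cardfs_gt0.
    by apply/fset0Pn; exists a; rewrite !inE/=; apply/andP; split=> //; apply/asboolP.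
  case: (n) mdn => //; rewrite mulr0 lern0 -/m.
  by move=> /eqP->.
- by move=> a; case: (hw a).
- by move=> a; case: (hw a).
- move=> x; have [a aA ax] : (\bigcup_(a in [set` A]) a) x by rewrite cvA.
  by exists [` aA]%fset; have [_ _ + _] := hw [` aA]%fset; apply.
have near_c x : exists2 c, forall (a : A) y, val a y -> mdist x y < rho ->
    mdist c y < r c /\ val a c & forall i, (i < n)%N -> mdist (T c i%:Z) (T x i%:Z) < eta / 5.
  have [c cx rc] := hrho x.
  move: cx rc; rewrite /r' => cx rc.
  have l1 : Num.min (r c) (s c) <= r c by rewrite ge_min lexx.
  have l2 : Num.min (r c) (s c) <= s c by rewrite ge_min lexx orbT.
  have m0 := r'0 c; rewrite /r' in m0.
  exists c => [a y ay xy|i lt_in]; last by apply: hr => //; lra.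
  have cy := metric_triangle c x y; split; first lra.
  apply: contrapT => nac; have := (hs c).2 (val a) (valP a) nac y ay; lra.
split=> [x|a x y i wx wy lt_in].
  apply: le_trans mdn; rewrite ler_nat.
  have [c hc _] := near_c x.
  apply: leq_trans (ge_cover_ord A c).
  rewrite cardE -(size_map val); apply: uniq_leq_size.
    by rewrite map_inj_uniq ?enum_uniq//; exact: val_inj.
  move=> _ /mapP[a + ->]; rewrite mem_enum inE => wa.
  rewrite !inE/= (valP a)/=; apply/asboolP.
  have [_ _ _ /(_ _ wa)[y ay xy]] := hw a.
  by case: (hc a y ay xy).
(* The bound [eta] is spent in fifths: two from [x] to the member, one inside it, two back to
   [y]. *)
have close x' : 0 < w a x' -> exists2 y', val a y' & mdist (T x' i%:Z) (T y' i%:Z) < 2 * (eta / 5).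
  move=> wx'; have [_ _ _ /(_ _ wx')[y' ay' xy']] := hw a.
  exists y' => //; have [c hc hci] := near_c x'.
  have [cy' _] := hc a y' ay' xy'.
  have := hr _ _ i lt_in cy'; have := hci i lt_in.
  have := metric_triangle (T x' i%:Z) (T c i%:Z) (T y' i%:Z).
  rewrite (metric_sym (T x' i%:Z) (T c _)); lra.
have [x' ax' xx'] := close x wx; have [y' ay' yy'] := close y wy.
have : mdist (T x' i%:Z) (T y' i%:Z) < eta / 5.
  apply: (mesh_translate_lt _ (valP a)) => //; apply: meshA.
  by apply/andP; split; [apply: mulr_ge0; [exact: ler0n|exact: ltW]|exact: small].
have := metric_triangle (T x i%:Z) (T x' i%:Z) (T y i%:Z).
have := metric_triangle (T x' i%:Z) (T y' i%:Z) (T y i%:Z).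
rewrite (metric_sym (T y' _) (T y _)); lra.
Qed.

End Cover.

(** * Markers and towers *)

Section Tower.
Context {R : realType} {X : metricType R} (T : int_action X).
Hypothesis cX : compact [set: X].
Hypothesis minT : minimal T.
Hypothesis freeT : forall x i, 0 < i -> T x i <> x.

Lemma continuous_translate (h : X -> R) (z : int) :
  continuous h -> continuous (fun x => h (T x z)).
Proof.
move=> hc x; apply: (@continuous_comp _ _ _ (fun x => T x z) h).
  exact: int_act_continuous.
exact: hc.
Qed.

(** Freeness makes a small ball around [p] disjoint from its translates by [1, ..., L - 1], which
    spaces the visits; minimality brings every orbit into the half ball, and compactness bounds the
    waiting time by [M]. *)
Lemma marker (p : X) (L : nat) : exists (M : nat) (psi : X -> R),
  [/\ continuous psi, forall x, 0 <= psi x <= 1,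
      forall x, exists t : int, - M%:Z <= t <= M%:Z /\ psi (T x t) = 1 &
      forall x (i : int), 0 < psi x -> 0 < psi (T x i) -> 0 < i -> L%:Z <= i].
Proof.
have [r r0 hr] : exists2 r, 0 < r & forall i, (0 < i < L)%N ->
    forall y, mdist p y < r -> r <= mdist p (T y i%:Z).
  elim: L => [|L [r r0 hr]]; first by exists 1 => // i; rewrite ltn0 andbF.
  have [->|L0] := posnP L.
    by exists 1 => // i; lia.
  pose e := mdist p (T p L%:Z) / 2.
  have e0 : 0 < e.
    rewrite divr_gt0// mdist_gt0; apply/eqP => pL.
    by apply: (@freeT p L%:Z); rewrite ?ltz_nat.
  have /metricType_numDomainType.cvgrPdist_lt/(_ e e0)
    /metricType_numDomainType.nbhs_mdistP [r' /= r'0 hr'] :=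
    (@int_act_continuous _ T L%:Z p).
  exists (Num.min r (Num.min r' e)); first by rewrite !lt_min r0 r'0.
  move=> i /andP[i0]; rewrite ltnS leq_eqVlt => /orP[/eqP->|iL] y.
    rewrite !lt_min => /and3P[_ /hr' + _]; rewrite !ge_min => h.
    have := metric_triangle p (T y L%:Z) (T p L%:Z).
    rewrite (metric_sym (T y _)); rewrite /e in h *.
    by move=> tr; apply/orP; right; apply/orP; right; move: h tr => /=; lra.
  by rewrite lt_min ge_min => /andP[/hr-> //]; rewrite i0.
pose psi x := Num.max 0 (Num.min 1 (2 - 2 * mdist p x / r)).
have cd : continuous (fun x => mdist p x).
  apply/continuous_mdistP => x e e0; exists e => // y xy.
  have := metric_triangle p x y; have := metric_triangle p y x.
  rewrite (metric_sym y x) => ? ?.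
  by rewrite ltr_norml; apply/andP; split; lra.
have cpsi : continuous psi.
  apply: continuous_maxr; first by move=> x; exact: cvg_cst.
  apply: continuous_minr; first by move=> x; exact: cvg_cst.
  move=> x; apply: cvgB; first exact: cvg_cst.
  by apply: cvgM; [apply: cvgM; [exact: cvg_cst|exact: cd]|exact: cvg_cst].
have psi_gt0 x : 0 < psi x -> mdist p x < r.
  rewrite lt_max ltxx/= lt_min => /andP[_].
  by rewrite subr_gt0 ltr_pdivrMr//; lra.
have psi1 x : mdist p x < r / 2 -> psi x = 1.
  move=> h; rewrite /psi (min_idPl _) ?max_r//.
  suff : 2 * mdist p x / r <= 1 by lra.
  by rewrite ler_pdivrMr//; lra.
have hit x : exists ts : int * R, 0 < ts.2 /\ forall y, mdist x y < ts.2 -> psi (T y ts.1) = 1.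
  have [||y [/= py [t _ xty]]] := @minT x (interior (ball p (r / 2))).
  - by exists p; apply: nbhsx_ballx; rewrite divr_gt0.
  - exact: open_interior.
  move/interior_subset: py => py.
  rewrite -xty ballEmdist/= in py.
  pose e := r / 2 - mdist p (T x t).
  have e0 : 0 < e by rewrite subr_gt0.
  have /metricType_numDomainType.cvgrPdist_lt/(_ e e0)
    /metricType_numDomainType.nbhs_mdistP [r' /= r'0 hr'] :=
    (@int_act_continuous _ T t x).
  exists (t, r'); split => //= u /hr' /= h; apply: psi1.
  by have := metric_triangle p (T x t) (T u t); rewrite /e in h; lra.
have [ts hts] := choice hit.
have [s hs] := compact_finite_balls cX (fun x => (hts x).1).
exists (\max_(c <- s) `|(ts c).1|%N), psi; split => //.
- by move=> x; rewrite le_max lexx/= ge_max ler01/= ge_min lexx.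
- move=> x; have [c cs cx] := hs x; exists (ts c).1; split; last exact: (hts c).2.
  have := @leq_bigmax_seq _ s predT (fun c => `|(ts c).1|%N) c cs isT.
  by move: (\max_(_ <- _) _)%N => m; lia.
move=> x i /psi_gt0 px /psi_gt0 pTx i0; rewrite leNgt; apply/negP => iL.
have [j ij] : exists j : nat, i = j%:Z by exists `|i|%N; lia.
subst i.
have jL : (0 < j < L)%N by lia.
by have := hr j jL x px; rewrite leNgt pTx.
Qed.


(** Minus the power distance from [z] to the site [t] of weight [psi (T x t)]. *)
Definition score (psi : X -> R) x (z t : int) : R :=
  psi (T x t) - ((z - t) ^+ 2)%:~R.

Lemma score_translate psi x i z t :
  score psi (T x i) z t = score psi x (z + i) (t + i).
Proof.
rewrite /score -int_actD [i + t]addrC; congr (_ - _%:~R); congr (_ ^+ 2); lia.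
Qed.

(** The squares of [z] cancel, so the lead of one site over another is affine in [z]. *)
Lemma score_diff psi x z t q :
  score psi x (z + 1) t - score psi x (z + 1) q =
  score psi x z t - score psi x z q + (2 * (t - q))%:~R.
Proof. by rewrite /score !expr2 !(intrM, intrB, intrD); ring. Qed.

Definition leader psi x z t := forall q, score psi x z q <= score psi x z t.

(** A step to the right favors the larger of two sites, so leaders move monotonically however ties
    are broken. *)
Lemma leader_le psi x z t t' : leader psi x z t -> leader psi x (z + 1) t' -> t <= t'.
Proof.
move=> /(_ t') h /(_ t); rewrite -subr_ge0 score_diff => h'.
have : (0 : R) <= (2 * (t' - t))%:~R by lra.
by rewrite ler0z; lia.
Qed.

(** The lead of [t] over [q] is affine in [z] with slope at least 2 in absolute value; being
    nonnegative at both neighbors, it is bounded away from 0 at [z]. *)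
Lemma leader_margin psi x z t q : q != t ->
  leader psi x (z - 1) t -> leader psi x (z + 1) t ->
  score psi x z q + 1 <= score psi x z t.
Proof.
move=> qt /(_ q) h1 /(_ q) h2.
have := score_diff psi x z t q; have := score_diff psi x (z - 1) t q.
rewrite subrK => e1 e2.
have [lt|lt] : 1 <= t - q \/ t - q <= -1 by lia.
  have : (1 : R) <= (t - q)%:~R by rewrite ler1z.
  by move: e1; rewrite intrM; lra.
have : (t - q)%:~R <= (-1)%:~R :> R by rewrite ler_int.
by move: e2; rewrite intrM; lra.
Qed.

(** A peak of height [M ^ 2 + 1] within [M] of [z] scores at least 1, and no site farther away
    scores more than 1, so the maximum over a finite window is global. *)
Lemma leader_exists psi (M : nat) x z :
  (forall x, psi x <= (M%:R ^+ 2 + 1)) ->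
  (forall x, exists t : int, - M%:Z <= t <= M%:Z /\ psi (T x t) = (M%:R ^+ 2 + 1)) ->
  exists t, [/\ leader psi x z t, z - M%:Z <= t <= z + M%:Z & 0 < psi (T x t)].
Proof.
move=> ub hit.
pose F (i : 'I_(2 * M).+1) := score psi x z (z - M%:Z + i%:Z).
have [i _ Fi] := @arg_maxP _ _ _ (@ord0 (2 * M)) predT F isT.
set t := z - M%:Z + i%:Z in F Fi *.
have tz : z - M%:Z <= t <= z + M%:Z by have := ltn_ord i; rewrite /t; lia.
have Ft q : z - M%:Z <= q <= z + M%:Z -> score psi x z q <= score psi x z t.
  move=> hq; have [j [lt ->]] : exists j : nat, (j < (2 * M).+1)%N /\ q = z - M%:Z + j%:Z.
    by exists `|(q - (z - M%:Z))%R|%N; lia.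
  exact: Fi (Ordinal lt) isT.
have t1 : 1 <= score psi x z t.
  have [s [hs es]] := hit (T x z).
  apply: le_trans (Ft (z + s) _); last lia.
  rewrite /score int_actD es.
  have : ((z - (z + s)) ^+ 2)%:~R <= (M%:Z ^+ 2)%:~R :> R by rewrite ler_int; nia.
  by rewrite rmorphXn/=; lra.
exists t; split => // [q|].
  have [|hq] := boolP (z - M%:Z <= q <= z + M%:Z); first exact: Ft.
  apply: le_trans t1; rewrite /score.
  have : (M%:Z ^+ 2)%:~R <= ((z - q) ^+ 2)%:~R :> R by rewrite ler_int; nia.
  by have := ub (T x q); rewrite rmorphXn/=; lra.
move: t1; rewrite /score.
have : (0 : R) <= ((z - t) ^+ 2)%:~R by rewrite ler0z; nia.
lra.
Qed.


(** [v x] is the margin, capped at 1, by which one site divisible by [n] beats its competitors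
    throughout the block [[0, n)]. Finitely many sites keep it continuous. *)
Lemma aligned_blocks psi (n h : nat) : (0 < n)%N -> continuous psi ->
  exists v : X -> R, [/\ continuous v, forall x, 0 <= v x <= 1,
    forall x, 0 < v x -> exists2 c : int, - h%:Z <= c <= h%:Z &
      forall (z : nat) q, (z < n)%N -> - (n * h.+1)%:Z <= q <= (n * h.+1)%:Z ->
        q != n%:Z * c -> score psi x z q < score psi x z (n%:Z * c) &
    forall x (c : int), - h%:Z <= c <= h%:Z ->
      (forall (z : nat) q, (z < n)%N -> q != n%:Z * c ->
        score psi x z q + 1 <= score psi x z (n%:Z * c)) -> v x = 1].
Proof.
move=> n0 cpsi.
pose t (c : 'I_(2 * h).+1) : int := n%:Z * (c%:Z - h%:Z).
(* Competitors reach [n] beyond the sites [n * c], so that two overlapping blocks see each other's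
   site. *)
pose u (q : 'I_(2 * (n * h.+1)).+1) : int := q%:Z - (n * h.+1)%:Z.
pose G x (c : 'I_(2 * h).+1) := \big[Num.min/1]_(z < n) \big[Num.min/1]_(q | u q != t c)
   (score psi x (z : nat) (t c) - score psi x (z : nat) (u q)).
pose v x := \big[Num.max/0]_c G x c.
have cscore z q : continuous (fun x => score psi x z q).
  by move=> x; apply: cvgB; [exact: continuous_translate|exact: cvg_cst].
have G1 x c : G x c <= 1 by rewrite /G; elim/big_rec: _ => // z y _ hy; rewrite ge_min hy orbT.
exists v; split.
- apply: continuous_big => [|c _].
    by move=> x; apply: continuous_maxr => y; [exact: cvg_fst|exact: cvg_snd].
  apply: continuous_big => [|z _].
    by move=> x; apply: continuous_minr => y; [exact: cvg_fst|exact: cvg_snd].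
  apply: continuous_big => [|q _].
    by move=> x; apply: continuous_minr => y; [exact: cvg_fst|exact: cvg_snd].
  by move=> x; apply: cvgB; exact: cscore.
- move=> x; apply/andP; split.
    by rewrite /v; elim/big_rec: _ => // c y _ hy; rewrite le_max hy orbT.
  by apply/bigmax_leP; split=> // c _; exact: G1.
- move=> x /bigmax_gtP[|]; first by rewrite ltxx.
  case=> c _ /bigmin_gtP[_ hG]; exists (c%:Z - h%:Z).
    by have := ltn_ord c; lia.
  move=> z q zn hq qt; have /bigmin_gtP[_ hz] := hG (Ordinal zn) isT.
  have [j [jl ej]] : exists j : nat, (j < (2 * (n * h.+1)).+1)%N /\ q = j%:Z - (n * h.+1)%:Z.
    by exists `|(q + (n * h.+1)%:Z)%R|%N; lia.
  by have := hz (Ordinal jl); rewrite /u/= -ej => /(_ qt); rewrite subr_gt0.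
move=> x c hc hm; apply/eqP; rewrite eq_le; apply/andP; split.
  by apply/bigmax_leP; split=> // i _; exact: G1.
have [j [jl ej]] : exists j : nat, (j < (2 * h).+1)%N /\ c = j%:Z - h%:Z.
  by exists `|(c + h%:Z)%R|%N; lia.
apply/bigmax_geP; right; exists (Ordinal jl) => //.
apply/bigmin_geP; split=> // z _.
apply/bigmin_geP; split=> // q.
rewrite /t/= -ej => hq; have := hm z (u q) (ltn_ord z) hq; lra.
Qed.


(* The block to which [T x tau] belongs is the one that starts at the largest
   [s <= tau] congruent to the leader modulo [n]; it is fully covered as soon as the leader
   does not change on [tau - n, tau + n]. *)
Lemma block_of_constant_leader psi (n M : nat) (v : X -> R) x (tau t : int) :
  (0 < n)%N ->
  (forall x (c : int), - (M + n)%:Z <= c <= (M + n)%:Z ->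
      (forall (z : nat) q, (z < n)%N -> q != n%:Z * c ->
        score psi x z q + 1 <= score psi x z (n%:Z * c)) -> v x = 1) ->
  tau - M%:Z <= t <= tau + M%:Z ->
  (forall z, tau - n%:Z <= z <= tau + n%:Z -> leader psi x z t) ->
  exists2 i : 'I_n, true & v (T x (tau - i%:Z)) = 1.
Proof.
move=> n0 hv ht lead.
have n0' : 0 < n%:Z by [].
have r0 : 0 <= ((tau - t) %% n%:Z)%Z by rewrite modz_ge0 ?gt_eqF.
have rn := ltz_pmod (tau - t) n0'.
have dE := divz_eq (tau - t) n%:Z.
set c := ((tau - t) %/ n)%Z in dE; set r := ((tau - t) %% n%:Z)%Z in r0 rn dE.
have rn' : (`|r| < n)%N by lia.
exists (Ordinal rn') => //=.
have -> : tau - `|r|%N%:Z = t + n%:Z * c by lia.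
(* Seen from the block start, the leader is the site [n * (- c)]. The times used by [leader_margin],
   one beyond the block on either side, stay within [[tau - n, tau + n]]. *)
apply: (hv _ (- c)); first by nia.
move=> z q zn; rewrite !score_translate => hq.
have -> : n%:Z * - c + (t + n%:Z * c) = t by lia.
apply: leader_margin; first by lia.
- by apply: lead; lia.
- by apply: lead; lia.
Qed.

(** Each increment consists of [2 * n] unit steps; for a fixed offset these telescope over [tau],
    and [t] stays within [M] of the identity. *)
Lemma sum_window_increments (t : int -> int) (n M W : nat) :
  (forall z, z - M%:Z <= t z <= z + M%:Z) ->
  \sum_(tau < W) (t (tau%:Z + n%:Z) - t (tau%:Z - n%:Z)) <= ((2 * n) * (W + 2 * M))%:Z.
Proof.
move=> ht.
have -> : \sum_(tau < W) (t (tau%:Z + n%:Z) - t (tau%:Z - n%:Z)) =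
    \sum_(j < 2 * n) \sum_(tau < W) (t (tau.+1%:Z + (j%:Z - n%:Z)) - t (tau%:Z + (j%:Z - n%:Z))).
  rewrite exchange_big; apply: eq_bigr => tau _ /=.
  rewrite -(big_mkord predT (fun j => t (tau.+1%:Z + (j%:Z - n%:Z)) - t (tau%:Z + (j%:Z - n%:Z)))).
  rewrite (@telescope_sumr_eq _ _ _ (fun j => t (tau%:Z + (j%:Z - n%:Z)))) //.
    by congr (t _ - t _); lia.
  by move=> j _; congr (t _ - t _); lia.
apply: (@le_trans _ _ (\sum_(j < 2 * n) (W + 2 * M)%:Z)); last first.
  by rewrite sumr_const card_ord -mulr_natl natrM; lia.
apply: ler_sum => j _.
rewrite -(big_mkord predT (fun tau => t (tau.+1%:Z + (j%:Z - n%:Z)) - t (tau%:Z + (j%:Z - n%:Z)))).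
rewrite (@telescope_sumr_eq _ _ _ (fun tau => t (tau%:Z + (j%:Z - n%:Z)))) //.
have := ht (W%:Z + (j%:Z - n%:Z)); have := ht (0%:Z + (j%:Z - n%:Z)); lia.
Qed.

(** Around a time covered by no block with [v = 1] the leader changes, and distinct leaders are
    visits to the marker, at least [L] apart. As the leader follows the time up to a bounded error,
    such times are rare. *)
Lemma tower (p : X) (n : nat) (eps : R) : (0 < n)%N -> 0 < eps ->
  exists (v : X -> R) (W0 : nat), [/\ continuous v, forall x, 0 <= v x <= 1,
    forall x (i : nat), 0 < v x -> 0 < v (T x i%:Z) -> (0 < i < n)%N -> False &
    forall W, (W0 <= W)%N -> forall x,
      #|[set tau : 'I_W | [forall i : 'I_n, v (T x (tau%:Z - i%:Z)) < 1]]%SET|%:R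
        <= eps * W%:R].
Proof.
move=> n0 eps0.
(* At most [4 * n * W / L] times of a window of length [W >= 2 * M] will be uncovered. *)
pose L := `|Num.ceil (4 * n%:R / eps)|.+1%N.
have L4 : 4 * n%:R <= eps * L%:R.
  rewrite [eps * _]mulrC -ler_pdivrMr//.
  have h : (Num.ceil (4 * n%:R / eps))%:~R <= (L%:Z)%:~R :> R by rewrite ler_int /L; lia.
  exact: le_trans (ceil_ge _) h.
have [M [psi0 [cpsi0 b01 hit sep]]] := marker p L.
pose H : R := M%:R ^+ 2 + 1.
have H0 : 0 < H by rewrite ltr_wpDl// sqr_ge0.
pose psi x := H * psi0 x.
have cpsi : continuous psi.
  by move=> x; apply: cvgM; [exact: cvg_cst|exact: cpsi0].
have ubpsi x : psi x <= M%:R ^+ 2 + 1.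
  by rewrite -/H /psi ger_pMr//; case/andP: (b01 x).
have hitpsi x : exists t : int, - M%:Z <= t <= M%:Z /\ psi (T x t) = M%:R ^+ 2 + 1.
  by have [t [ht e]] := hit x; exists t; split=> //; rewrite /psi e mulr1.
have [v [cv v01 vA vB]] := aligned_blocks (M + n) n0 cpsi.
exists v, (2 * M)%N; split => //.
- move=> x i vx vTx /andP[i0 lt_in].
  have [c hc hm] := vA _ vx; have [c' hc' hm'] := vA _ vTx.
  (* Both blocks contain the time [i]. If their sites coincide, [n] divides [i]; otherwise each site
     strictly beats the other at that time. *)
  have [e|ne] := eqVneq (n%:Z * c' + i%:Z) (n%:Z * c).
    have [|] : 1 <= c - c' \/ c - c' <= 0 by lia.
      by nia.
    by nia.
  have := hm i (n%:Z * c' + i%:Z) lt_in _ ne.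
  have := hm' 0%N (n%:Z * c - i%:Z) n0 _ _.
  rewrite !score_translate subrK add0r.
  have h1 : - (n * (M + n).+1)%:Z <= n%:Z * c - i%:Z <= (n * (M + n).+1)%:Z by nia.
  have h2 : - (n * (M + n).+1)%:Z <= n%:Z * c' + i%:Z <= (n * (M + n).+1)%:Z by nia.
  move=> /(_ h1) h3 /(_ h2); have := h3 _; rewrite ltNge => /(_ _)/negP h4 h5.
  by apply: h4; [lia|exact: ltW].
move=> W W0 x; set B := [set _ | _]%SET.
have [t ht] := choice (fun z => leader_exists x z ubpsi hitpsi).
have tle1 z : t z <= t (z + 1).
  by have [h1 _ _] := ht z; have [h2 _ _] := ht (z + 1); exact: leader_le h1 h2.
have tle z (j : nat) : t z <= t (z + j%:Z).
  elim: j => [|j IH]; first by rewrite addr0.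
  by apply: le_trans IH _; rewrite -addn1 PoszD addrA.
have tM z : z - M%:Z <= t z <= z + M%:Z by case: (ht z).
have jump (tau : 'I_W) : tau \in B -> L%:Z <= t (tau%:Z + n%:Z) - t (tau%:Z - n%:Z).
  rewrite inE => /forallP bad.
  have t_le : t (tau%:Z - n%:Z) <= t (tau%:Z + n%:Z).
    by have := tle (tau%:Z - n%:Z) (2 * n)%N; congr (_ <= t _); lia.
  have [e|ne] := eqVneq (t (tau%:Z - n%:Z)) (t (tau%:Z + n%:Z)).
    have lead z : tau%:Z - n%:Z <= z <= tau%:Z + n%:Z -> leader psi x z (t tau%:Z).
      have cst z' : tau%:Z - n%:Z <= z' <= tau%:Z + n%:Z -> t z' = t (tau%:Z + n%:Z).
        move=> hz'; apply/eqP; rewrite eq_le -{2}e; apply/andP; split.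
          by have := tle z' `|(tau%:Z + n%:Z - z')%R|%N; congr (_ <= t _); lia.
        by have := tle (tau%:Z - n%:Z) `|(z' - (tau%:Z - n%:Z))%R|%N; congr (_ <= t _); lia.
      move=> hz; rewrite (cst tau%:Z); last by lia.
      by rewrite -(cst z)//; case: (ht z).
    have [i _ vi] := block_of_constant_leader n0 vB (tM tau%:Z) lead.
    by have := bad i; rewrite vi ltxx.
  have [_ _ p1] := ht (tau%:Z - n%:Z); have [_ _ p2] := ht (tau%:Z + n%:Z).
  rewrite /psi !pmulr_rgt0// in p1 p2.
  apply: (sep (T x (t (tau%:Z - n%:Z)))) => //; last by lia.
  by rewrite -int_actD addrC subrK.
have LB : L%:Z * #|B|%:Z <= ((2 * n) * (W + 2 * M))%:Z.
  apply: le_trans (sum_window_increments n W tM).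
  rewrite (bigID (mem B))/=; apply: ler_wpDr.
    apply: sumr_ge0 => tau _; rewrite subr_ge0.
    by have := tle (tau%:Z - n%:Z) (2 * n)%N; congr (_ <= t _); lia.
  apply: (@le_trans _ _ (\sum_(tau in B) L%:Z)); last exact: ler_sum.
  by rewrite sumr_const -mulr_natr natz.
have {}LB : L%:R * #|B|%:R <= 4 * n%:R * W%:R :> R.
  rewrite -!natrM ler_nat; nia.
have L0 : 0 < L%:R :> R by [].
rewrite -(ler_pM2l L0); apply: le_trans LB _.
by rewrite mulrA [_ * eps]mulrC ler_wpM2r.
Qed.

End Tower.

(** * Coding by threshold bits *)

Section Coding.
Context {R : realType}.

Definition clamp (t : R) : R := Num.max 0 (Num.min 1 t).

Lemma clamp_itv t : 0 <= clamp t <= 1.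
Proof. by rewrite /clamp le_max lexx/= ge_max ler01/= ge_min lexx. Qed.

Lemma clamp_id t : 0 <= t <= 1 -> clamp t = t.
Proof. by move=> /andP[t0 t1]; rewrite /clamp (min_idPr t1) (max_idPr t0). Qed.

Lemma continuous_clamp {T : topologicalType} (h : T -> R) :
  continuous h -> continuous (fun x => clamp (h x)).
Proof.
move=> hc; apply: continuous_maxr; first by move=> x; exact: cvg_cst.
by apply: continuous_minr => // x; exact: cvg_cst.
Qed.

(* The thresholds [m / 2K <= w <= (m + 1) / 2K] of the different bits do not overlap, so a given
   value [w] leaves at most one of them undecided; all are decided once [w >= 1/2]. *)
Definition bit (K m : nat) (w : R) : R := clamp (2 * K%:R * w - m%:R).

Definition decided (t : R) := (t == 0) || (t == 1).

Lemma bit_undecided K m w : ~~ decided (bit K m w) -> m%:R < 2 * K%:R * w < m.+1%:R.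
Proof.
rewrite /decided /bit /clamp -natr1 => h; apply/andP; split; rewrite ltNge; apply: contra h => h.
  by apply/orP; left; apply/eqP; rewrite (max_idPl _)// ge_min; apply/orP; right; lra.
by apply/orP; right; apply/eqP; rewrite (min_idPl _) ?(max_idPr _)//; lra.
Qed.

Lemma bit_undecided_inj K m m' w :
  ~~ decided (bit K m w) -> ~~ decided (bit K m' w) -> m = m'.
Proof.
move=> /bit_undecided/andP[a b] /bit_undecided/andP[c d].
have := lt_trans a d; have := lt_trans c b; rewrite !ltr_nat; lia.
Qed.

Lemma bit_ge K m w : (m < K)%N -> 1 / 2 <= w -> bit K m w = 1.
Proof.
move=> mK hw; rewrite /bit /clamp (min_idPl _) ?(max_idPr _)//.
have : m.+1%:R <= K%:R :> R by rewrite ler_nat.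
rewrite -natr1 => h; have : K%:R * 1 <= K%:R * (2 * w) :> R by rewrite ler_wpM2l//; lra.
lra.
Qed.

Lemma bit_le0 K m w : w <= 0 -> bit K m w = 0.
Proof.
move=> w0; rewrite /bit /clamp (max_idPl _)// ge_min; apply/orP; right.
have : K%:R * w <= 0 by rewrite mulr_ge0_le0.
have : 0 <= m%:R :> R by []. lra.
Qed.

Lemma bit_undecided_itv K m w : (m < K)%N -> ~~ decided (bit K m w) -> 0 < w < 1.
Proof.
move=> mK h; apply/andP; split; rewrite ltNge; apply: contra h => h; rewrite /decided.
  by rewrite bit_le0// eqxx.
by rewrite bit_ge ?eqxx ?orbT//; lra.
Qed.

Lemma continuous_bit {T : topologicalType} (h : T -> R) K m :
  continuous h -> continuous (fun x => bit K m (h x)).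
Proof.
move=> hc; apply: continuous_clamp => x; apply: cvgB; last exact: cvg_cst.
by apply: cvgM; [exact: cvg_cst|exact: hc].
Qed.

Section Multilinear.
Context {A : finType}.
Implicit Types (val : {ffun A -> bool} -> R) (b : A -> R).

(** The multilinear interpolation on the cube [[0, 1]^A] of a function given at its vertices. *)
Definition multilinear val b : R :=
  \sum_S val S * \prod_a (if S a then b a else 1 - b a).

Definition code b : {ffun A -> bool} := [ffun a => b a == 1].

Lemma multilinear_code val b : (forall a, decided (b a)) -> multilinear val b = val (code b).
Proof.
move=> hb; rewrite /multilinear (bigD1 (code b))//= [X in _ + X]big1 ?addr0.
  rewrite big1 ?mulr1// => a _; rewrite ffunE; have /orP[/eqP->|/eqP->] := hb a.
    by rewrite eq_sym oner_eq0 subr0.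
  by rewrite eqxx.
move=> S /eqP SNb; have [a Sa] : exists a, S a != code b a.
  by apply/existsP; apply: contra_notT SNb; rewrite negb_exists => /forallP h;
    apply/ffunP => a; apply/eqP; rewrite -[_ == _]negbK.
rewrite (bigD1 a)//= (_ : (if S a then _ else _) = 0) ?mul0r ?mulr0//.
move: Sa; rewrite ffunE; have /orP[/eqP->|/eqP->] := hb a.
  by rewrite [0 == 1]eq_sym oner_eq0; case: (S a).
by rewrite eqxx; case: (S a) => //; rewrite subrr.
Qed.

Lemma continuous_multilinear {T : topologicalType} val (b : T -> A -> R) :
  (forall a, continuous (b^~ a)) -> continuous (fun x => multilinear val (b x)).
Proof.
move=> hb; apply: continuous_sum => S x; apply: cvgM; first exact: cvg_cst.
apply: (continuous_prod (h := fun a x => if S a then b x a else 1 - b x a)) => a y.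
case: (S a); first exact: hb.
by apply: cvgB; [exact: cvg_cst|exact: hb].
Qed.

End Multilinear.

(* The values are multiples of [1 / (N Q)] whose residues mod [N = #|E|.+1] are pairwise
   different. *)
Lemma separated_values (E : finType) (c : E -> R) (eps : R) : 0 < eps ->
  (forall e, 0 <= c e <= 1) ->
  exists (val : E -> R) (gam : R), [/\ 0 < gam <= eps,
    forall e, `|val e - c e| <= eps, forall e, 0 <= val e /\ val e + gam <= 1 &
    forall e e', e != e' -> 2 * gam <= `|val e - val e'| ].
Proof.
move=> eps0 c01.
pose Q := `|Num.ceil (2 / eps)|.+1%N.
have Q0 : 0 < Q%:R :> R by [].
have hQ : 2 / eps <= Q%:R.
  have h : (Num.ceil (2 / eps))%:~R <= (Q%:Z)%:~R :> R by rewrite ler_int /Q; lia.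
  exact: le_trans (ceil_ge _) h.
have {}hQ : 2 / Q%:R <= eps.
  by rewrite ler_pdivrMr// mulrC -ler_pdivrMr.
pose N := #|E|.+1; have N0 : 0 < N%:R :> R by [].
have Nn0 : N%:R != 0 :> R by rewrite gt_eqF.
have Qn0 : Q%:R != 0 :> R by rewrite gt_eqF.
have hm e : exists m : nat, (m < Q)%N /\ m%:R <= Q%:R * c e <= m%:R + 1.
  have /andP[c0 c1] := c01 e.
  have Qc0 : 0 <= Q%:R * c e by rewrite mulr_ge0.
  have /andP[h1 h2] := truncn_itv Qc0.
  have [mQ|Qm] := ltnP (Num.truncn (Q%:R * c e)) Q.
    by exists (Num.truncn (Q%:R * c e)); split; rewrite // h1/= natr1 ltW.
  (* At the right end the last cell is taken, so that [val e + gam] stays at most 1. *)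
  exists Q.-1; split; first by [].
  have e1 : Q%:R = Q.-1%:R + 1 :> R by rewrite natr1.
  have h3 : Q%:R <= (Num.truncn (Q%:R * c e))%:R :> R by rewrite ler_nat.
  have h4 : Q%:R * c e <= Q%:R * 1 by rewrite ler_wpM2l.
  by apply/andP; split; lra.
have [m hmE] := choice hm.
pose r (e : E) : nat := enum_rank e.
have rN e : (r e < N)%N by have := ltn_ord (enum_rank e); rewrite /N /r => h; rewrite ltnS; apply: ltnW.
have r1 e : 0 <= (r e)%:R :> R /\ (r e)%:R + 1 <= N%:R :> R.
  by split=> //; rewrite natr1 ler_nat.
pose val e : R := (m e * N + r e)%:R / (N%:R * Q%:R).
pose gam : R := 1 / (2 * (N%:R * Q%:R)).
have NQ0 : 0 < N%:R * Q%:R :> R by exact: mulr_gt0.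
have gam2 : 2 * gam = 1 / (N%:R * Q%:R) by rewrite /gam; field; rewrite Qn0.
have gamN : gam * (N%:R * Q%:R) = 1 / 2 by rewrite /gam; field; rewrite Qn0.
have normNQ (t : R) : `|t| * (N%:R * Q%:R) = `|t * (N%:R * Q%:R)|.
  by rewrite [in RHS]normrM (gtr0_norm NQ0).
have valN e : val e * (N%:R * Q%:R) = (m e)%:R * N%:R + (r e)%:R.
  by rewrite /val natrD natrM divfK// mulf_neq0.
have N1 : 1 <= N%:R :> R by rewrite ler1n.
have Q1 : 1 <= Q%:R :> R by rewrite ler1n.
exists val, gam; split.
- rewrite divr_gt0 ?mulr_gt0//=; apply: le_trans hQ.
  rewrite -(ler_pM2r NQ0) gamN.
  have -> : 2 / Q%:R * (N%:R * Q%:R) = 2 * N%:R :> R by field.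
  lra.
- move=> e; apply: le_trans hQ.
  have [_ /andP[h1 h2]] := hmE e; have [h3 h4] := r1 e.
  rewrite -(ler_pM2r NQ0) normNQ mulrBl valN.
  have -> : 2 / Q%:R * (N%:R * Q%:R) = 2 * N%:R :> R by field.
  have h1' : (m e)%:R * N%:R <= Q%:R * c e * N%:R by rewrite ler_wpM2r.
  have h2' : Q%:R * c e * N%:R <= ((m e)%:R + 1) * N%:R by rewrite ler_wpM2r.
  by rewrite ler_norml; apply/andP; split; lra.
- move=> e; split; first by rewrite divr_ge0 // ltW.
  have [mQ _] := hmE e; have [h3 h4] := r1 e.
  rewrite -(ler_pM2r NQ0) mulrDl valN gamN mul1r.
  have h5 : (m e)%:R + 1 <= Q%:R :> R by rewrite natr1 ler_nat.
  have : ((m e)%:R + 1) * N%:R <= Q%:R * N%:R :> R by rewrite ler_wpM2r.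
  lra.
move=> e e' ee'; rewrite gam2 ler_pdivrMr// normNQ mulrBl !valN.
have ne : (m e * N + r e)%N != (m e' * N + r e')%N.
  apply: contra ee' => /eqP /(congr1 (modn^~ N)).
  by rewrite !modnMDl !modn_small// => /ord_inj/enum_rank_inj->.
have [lt|lt] : ((m e * N + r e).+1 <= m e' * N + r e')%N \/ ((m e' * N + r e').+1 <= m e * N + r e)%N.
- by move: ne; case: ltngtP; [left|right|].
- rewrite distrC; apply: le_trans (ler_norm _).
  by move: lt; rewrite -(ler_nat R) -natr1 !natrD !natrM; lra.
apply: le_trans (ler_norm _).
by move: lt; rewrite -(ler_nat R) -natr1 !natrD !natrM; lra.
Qed.

Definition all_decided (A : finType) (b : A -> R) := [forall a, decided (b a)].

Lemma continuous_cst {T : topologicalType} (c : R) : continuous (fun _ : T => c).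
Proof. by move=> x; exact: cvg_cst. Qed.

(* [g] is the value of the cell [(i, code)] plus a perturbation [gam * kappa] smaller than half
   the gaps between these values, so it determines the cell even where the bits
   [eb] that make up [kappa] are not decided. *)
Lemma coding (X : topologicalType) (I A B : finType) (P : I -> X -> R)
    (cb : I -> X -> A -> R) (eb : X -> B -> R) (f : X -> R) (eps : R) :
  0 < eps -> continuous f -> (forall x, 0 <= f x <= 1) ->
  (forall i, continuous (P i)) -> (forall i i' x, P i x = 1 -> i' != i -> P i' x = 0) ->
  (forall i a, continuous (fun x => cb i x a)) -> (forall b, continuous (fun x => eb x b)) ->
  (forall i x y, P i x = 1 -> P i y = 1 ->
     all_decided (cb i x) -> all_decided (cb i y) -> code (cb i x) = code (cb i y) ->
     `|f x - f y| <= eps / 2) ->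
  exists (g : X -> R) (del : R), [/\ 0 < del, continuous g, forall x, 0 <= g x <= 1,
    forall x, `|g x - f x| <= eps &
    forall i i' x y, P i x = 1 -> P i' y = 1 ->
      all_decided (cb i x) -> all_decided (cb i' y) -> `|g x - g y| <= 2 * del ->
      [/\ i = i', code (cb i x) = code (cb i' y) &
          all_decided (eb x) -> all_decided (eb y) -> code (eb x) = code (eb y)]].
Proof.
move=> eps0 cf f01 cP P01 ccb ceb fcl.
pose E := (I * {ffun A -> bool})%type.
pose incell (e : E) x := [/\ P e.1 x = 1, all_decided (cb e.1 x) & code (cb e.1 x) = e.2].
(* On a cell [f] varies by at most [eps / 2], so its value at any point of the cell will do; an
   empty cell gets the default 0. *)
have hc (e : E) : exists c : R, 0 <= c <= 1 /\ forall x, incell e x -> `|c - f x| <= eps / 2.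
  have [[p [p1 p2 p3]]|no] := pselect (exists p, incell e p).
    exists (f p); split=> // x [x1 x2 x3]; apply: (fcl e.1) => //; exact: etrans p3 (esym x3).
  by exists 0; split=> [|x ex]; [rewrite lexx ler01|case: no; exists x].
have [c hcE] := choice hc.
have e4 : 0 < eps / 4 by rewrite divr_gt0.
have [val [gam [/andP[gam0 game] valc val01 valsep]]] := separated_values e4 (fun e => (hcE e).1).
pose N := #|{ffun B -> bool}|.
have N0 : 0 < N%:R :> R.
  by rewrite ltr0n; apply/card_gt0P; exists (code (fun=> 0)).
pose rk (S : {ffun B -> bool}) : R := (enum_rank S)%:R / N%:R.
pose kap x := clamp (multilinear rk (eb x)).
pose raw x := \sum_i P i x * multilinear (fun S => val (i, S)) (cb i x) + gam * kap x.
(* Where bits are undecided, [raw] may be far from [f]; cutting it to [[f - eps, f + eps]] repairs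
   this and changes nothing on cells. *)
pose g x := clamp (Num.max (f x - eps) (Num.min (f x + eps) (raw x))).
have kapE x : all_decided (eb x) -> kap x = rk (code (eb x)).
  move=> /forallP h; rewrite /kap multilinear_code// clamp_id// /rk.
  by rewrite divr_ge0// ler_pdivrMr//= mul1r ler_nat ltnW// ltn_ord.
have rawE i x : P i x = 1 -> all_decided (cb i x) ->
    raw x = val (i, code (cb i x)) + gam * kap x.
  move=> Pi /forallP h; rewrite /raw (bigD1 i)//= big1 ?addr0.
    by rewrite Pi mul1r multilinear_code.
  by move=> i' /(P01 _ _ _ Pi) ->; rewrite mul0r.
have gE i x : P i x = 1 -> all_decided (cb i x) ->
    g x = val (i, code (cb i x)) + gam * kap x.
  move=> Pi h; rewrite /g (rawE i)//; set e := (i, _).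
  have := (hcE e).2 x (And3 Pi h erefl); have := valc e.
  have [v0 v1] := val01 e; have /andP[k0 k1] := clamp_itv (multilinear rk (eb x)).
  have gk0 : 0 <= gam * kap x by rewrite mulr_ge0// ltW.
  have gk1 : gam * kap x <= gam * 1 by rewrite ler_wpM2l// ltW.
  rewrite !ler_norml => /andP[a1 a2] /andP[b1 b2].
  rewrite (min_idPr _) ?(max_idPr _) ?clamp_id//; first by apply/andP; split; lra.
    by lra.
  by lra.
(* Different codes of [eb] shift the value by at least [gam / N], twice as much as [2 * del]. *)
pose del := gam / (4 * N%:R).
have N1 : 1 <= N%:R :> R by rewrite ler1n -(ltr0n R).
have delN : 2 * del * N%:R = gam / 2 by rewrite /del; field; rewrite gt_eqF.
have del0 : 0 < del by rewrite divr_gt0// mulr_gt0.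
have delg : 2 * del <= gam / 2 by rewrite -delN ler_peMr// mulr_ge0// ltW.
exists g, del; split => //.
- have craw : continuous raw.
    move=> x; apply: cvgD; last first.
      apply: cvgM; first exact: cvg_cst.
      by apply: (continuous_clamp (h := fun x => multilinear rk (eb x))); exact: continuous_multilinear.
    apply: (continuous_sum (h := fun i x => P i x * multilinear (fun S => val (i, S)) (cb i x))).
    move=> i y; apply: cvgM; first exact: cP.
    by apply: (continuous_multilinear (b := cb i)); exact: ccb.
  apply: continuous_clamp; apply: continuous_maxr.
    by move=> x; apply: cvgB; [exact: cf|exact: cvg_cst].
  by apply: continuous_minr => // x; apply: cvgD; [exact: cf|exact: cvg_cst].
- by move=> x; exact: clamp_itv.
- move=> x; have /andP[f0 f1] := f01 x; rewrite /g /clamp.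
  have h1 : f x - eps <= Num.max (f x - eps) (Num.min (f x + eps) (raw x)) <= f x + eps.
    by rewrite le_max lexx/= ge_max ge_min lexx/= andbT; lra.
  move: h1; set r := Num.max (f x - eps) _ => /andP[r1 r2].
  have h2 : f x - eps <= Num.min 1 r by rewrite le_min r1 andbT; lra.
  have h3 : Num.min 1 r <= f x + eps by rewrite ge_min r2 orbT.
  have h4 : f x - eps <= Num.max 0 (Num.min 1 r) by rewrite le_max h2 orbT.
  have h5 : Num.max 0 (Num.min 1 r) <= f x + eps by rewrite ge_max h3 andbT; lra.
  by rewrite ler_norml; apply/andP; split; lra.
move=> i i' x y Px Py hx hy.
rewrite (gE i)// (gE i')//; set e := (i, _); set e' := (i', _).
have /andP[k0 k1] := clamp_itv (multilinear rk (eb x)).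
have /andP[l0 l1] := clamp_itv (multilinear rk (eb y)).
have gk0 : 0 <= gam * kap x by rewrite mulr_ge0// ltW.
have gk1 : gam * kap x <= gam * 1 by rewrite ler_wpM2l// ltW.
have gl0 : 0 <= gam * kap y by rewrite mulr_ge0// ltW.
have gl1 : gam * kap y <= gam * 1 by rewrite ler_wpM2l// ltW.
(* The values of distinct cells are [2 * gam] apart and the perturbations differ by at most [gam],
   which leaves more than [2 * del]. *)
have [ee'|/valsep] := eqVneq e e'; last first.
  rewrite ler_norml => h /andP[h1 h2]; exfalso; move: h.
  rewrite leNgt => /negP; apply; rewrite ltr_norml; apply/andP; split; lra.
rewrite ee' opprD addrACA subrr add0r -mulrBr => hd.
have [ii' cc'] : i = i' /\ code (cb i x) = code (cb i' y) by case: ee'.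
split=> // dx dy; move: hd; rewrite !kapE// /rk -mulrBl.
rewrite -(ler_pM2r N0) delN -[X in _ * X]gtr0_norm// -normrM -mulrA divfK ?gt_eqF//.
rewrite normrM (gtr0_norm gam0) ler_pM2l// => h.
apply/enum_rank_inj/val_inj => /=; apply/eqP; rewrite eqn_leq.
move: h; rewrite ler_norml => /andP[h1 h2].
by apply/andP; split; rewrite leqNgt; apply/negP; rewrite -(ler_nat R) -natr1; lra.
Qed.

End Coding.

(** * Undecided coordinates *)

Section Combinatorics.

(** Choosing for each such [m] one element of [A0] that kills it is injective. *)
Lemma card_killed (M A : finType) (kill : M -> A -> bool) (A0 : {set A}) :
  (forall m m' a, kill m a -> kill m' a -> m = m') ->
  (#|[set m | [exists a in A0, kill m a]]%SET| <= #|A0|)%N.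
Proof.
move=> inj; set B := [set m | _]%SET.
have hB m : m \in B -> exists a, (a \in A0) && kill m a.
  by rewrite inE => /existsP[a h]; exists a.
have [B0|[m0 m0B]] := set_0Vmem B; first by rewrite B0 cards0.
have [a0 _] := hB m0 m0B.
pose h m := if [pick a | (a \in A0) && kill m a] is Some a then a else a0.
have hP m : m \in B -> (h m \in A0) && kill m (h m).
  by move=> /hB[a ha]; rewrite /h; case: pickP => [//|/(_ a)]; rewrite ha.
rewrite -(card_in_imset (f := h)).
  by apply: subset_leq_card; apply/fintype.subsetP => _ /imsetP[m /hP/andP[? _] ->].
by move=> m m' /hP/andP[_ h1] /hP/andP[_ h2] e; apply: inj h1 _; rewrite e.
Qed.

Lemma card_disjoint_family (L M : finType) (F : L -> {set M}) :
  (forall l l' m, m \in F l -> m \in F l' -> l = l') ->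
  (\sum_l #|F l| <= #|M|)%N.
Proof.
move=> inj.
have -> : (\sum_l #|F l| = \sum_(m : M) \sum_l (m \in F l))%N.
  by rewrite exchange_big; apply: eq_bigr => l _; rewrite -sum1_card big_mkcond.
rewrite -sum1_card; apply: leq_sum => m _.
have [/existsP[l lm]|/existsPn no] := boolP [exists l, m \in F l].
  rewrite (bigD1 l)//= big1 ?addn0 ?leq_b1// => l' l'l.
  by apply/eqP; rewrite eqb0; apply: contra l'l => /inj/(_ lm)->.
by rewrite big1// => l _; rewrite (negbTE (no l)).
Qed.

(** Pairwise disjoint sets would together have at least [a.+1 * (#|M| - c)] elements, too many for
    [M]. *)
Lemma card_disjoint_family_lt {R : realType} (a : nat) (M : finType)
    (F : 'I_a.+1 -> {set M}) (c : R) :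
  (forall l, #|~: F l|%:R <= c) ->
  #|M|%:R < a.+1%:R * (#|M|%:R - c) ->
  exists l l' m, [/\ l != l', m \in F l & m \in F l'].
Proof.
move=> hF; apply: contraPP => no.
apply/negP; rewrite -leNgt.
have : (\sum_l #|F l| <= #|M|)%N.
  apply: card_disjoint_family => l l' m lm l'm; apply/eqP.
  by apply: contra_notT no => ll'; exists l, l', m.
rewrite -(ler_nat R) natr_sum; apply: le_trans.
have -> : a.+1%:R * (#|M|%:R - c) = \sum_(l < a.+1) (#|M|%:R - c).
  by rewrite sumr_const card_ord mulr_natl.
by apply: ler_sum => l _; have := hF l; rewrite -(cardsC (F l)) natrD; lra.
Qed.

Lemma injection_of_card (a : nat) (M : finType) (S : {set M}) : (a < #|S|)%N ->
  exists2 phi : 'I_a.+1 -> M, injective phi & forall l, phi l \in S.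
Proof.
move=> aS; exists (fun l => enum_val (widen_ord aS l)) => [l l'|l]; last exact: enum_valP.
by move/enum_val_inj/(congr1 val) => /= /val_inj.
Qed.

(** If every key is shared by at most [a] of the more than [a * a] indices, then more than [a] keys
    occur. *)
Lemma pigeonhole_square (a r : nat) (K : finType) (key : 'I_r -> K) : (a * a < r)%N ->
  (exists c (phi : 'I_a.+1 -> 'I_r), injective phi /\ forall l, key (phi l) = c) \/
  (exists phi : 'I_a.+1 -> 'I_r, injective (key \o phi)).
Proof.
move=> ar; have [/existsP[c /injection_of_card[phi injphi hphi]]|/existsPn small] :=
    boolP [exists c, a < #|[set l | key l == c]%SET|]%N.
  by left; exists c, phi; split=> // l; have := hphi l; rewrite inE => /eqP.
right; pose K0 := [set key l | l : 'I_r]%SET.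
have /injection_of_card[psi injpsi hpsi] : (a < #|K0|)%N.
  rewrite ltnNge; apply/negP => K0a; move: ar; rewrite ltnNge => /negP; apply.
  rewrite -[r]card_ord -sum1_card (partition_big key (mem K0))/=; last first.
    by move=> l _; exact: imset_f.
  apply: (@leq_trans (\sum_(c in K0) a)%N); last by rewrite sum_nat_const leq_mul2r K0a orbT.
  apply: leq_sum => c _; have := small c; rewrite -leqNgt; apply: leq_trans.
  by rewrite sum1dep_card.
have /choice[phi hphi] : forall l, exists x, key x = psi l.
  by move=> l; have /imsetP[x _ e] := hpsi l; exists x.
by exists phi => l l' /=; rewrite !hphi => /injpsi.
Qed.

Lemma muln_addn_inj (n i i' j j' : nat) : (i < n)%N -> (i' < n)%N ->
  (j * n + i = j' * n + i')%N -> j = j' /\ i = i'.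
Proof.
move=> lt lt' e; have n0 : (0 < n)%N by apply: leq_ltn_trans lt.
have := congr1 (divn^~ n) e; have := congr1 (modn^~ n) e.
by rewrite !modnMDl !modn_small// !divnMDl// !divn_small// !addn0.
Qed.

End Combinatorics.

Lemma dist_opp_ord n (i i' : 'I_n) : `|- i%:Z - - i'%:Z| < n%:Z.
Proof. by have := ltn_ord i; have := ltn_ord i'; lia. Qed.

Section Counting.
Context {R : realType} {X : metricType R} (T : int_action X).
Variables (n : nat) (A : finType) (w : A -> X -> R) (v : X -> R) (d : R).
Hypothesis wcard : forall x, #|[set a | 0 < w a x]%SET|%:R <= d * n%:R.
Hypothesis v01 : forall x, 0 <= v x <= 1.
Hypothesis vdisj : forall x (i : nat), 0 < v x -> 0 < v (T x i%:Z) -> (0 < i < n)%N -> False.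

Lemma block_start_inj x (s s' : int) : 0 < v (T x s) -> 0 < v (T x s') ->
  `|s - s'| < n%:Z -> s = s'.
Proof.
wlog le : s s' / s <= s'.
  move=> h vs vs' lt; have [le|/ltW le] := leP s s'; first exact: h.
  by apply/esym/h => //; rewrite distrC.
move=> vs vs' lt; apply/eqP; apply: contrapT => ne.
have [i ei] : exists i : nat, s' = s + i%:Z by exists `|(s' - s)%R|%N; lia.
apply: (vdisj (i := i) vs); first by rewrite -int_actD -ei.
by move: lt ne; rewrite ei; lia.
Qed.

(** At phase [i] the block started at [T x (- i)]. The thresholds [j * n + i] differ for all [k * n]
    coordinates of a block. *)
Definition cell_bits (k : nat) (j : 'I_k) (i : 'I_n) (x : X) (a : A) : R :=
  bit (k * n) (j * n + i) (w a (T x (- i%:Z))).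

Lemma index_ltn (k N : nat) (j : 'I_k) (i : 'I_N) : (j * N + i < k * N)%N.
Proof. by have := ltn_ord j; have := ltn_ord i; nia. Qed.

Lemma cell_bits_translate k (j : 'I_k) (i : 'I_n) x (t : int) a :
  cell_bits j i (T x t) a = bit (k * n) (j * n + i) (w a (T x (t - i%:Z))).
Proof. by rewrite /cell_bits -int_actD. Qed.

(** A function positive at the block start leaves at most one coordinate undecided, and a function
    vanishing there leaves none. *)
Lemma card_undecided_in_block (k : nat) x :
  #|[set m : 'I_k * 'I_n | ~~ all_decided (cell_bits m.1 m.2 (T x (m.2 : nat)%:Z))]%SET|%:R
    <= d * n%:R.
Proof.
apply: le_trans (wcard x); rewrite ler_nat.
pose kill (m : 'I_k * 'I_n) a := ~~ decided (bit (k * n) (m.1 * n + m.2) (w a x)).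
apply: leq_trans (card_killed (kill := kill) _ _) => [|[j i] [j' i'] a].
  apply: subset_leq_card; apply/fintype.subsetP => -[j i]; rewrite !inE /=.
  rewrite negb_forall => /existsP[a]; rewrite cell_bits_translate subrr int_act0 => h.
  apply/existsP; exists a; rewrite inE /kill h andbT.
  by have /andP[] := bit_undecided_itv (index_ltn j i) h.
rewrite /kill/= => h h'.
have [e1 e2] := muln_addn_inj (ltn_ord i) (ltn_ord i') (bit_undecided_inj h h').
by congr pair; apply: val_inj.
Qed.

(** The blocks counted are disjoint and fit into an interval of length [W + 2 * n]. Starts from
    [- n] on are included, since a block that meets the window may begin before it. *)
Lemma card_block_starts (W : nat) x :
  (#|[set s : 'I_(W + n) | (1 / 2 <= v (T x ((s : nat)%:Z - n%:Z)))%R]%SET| * n <= W + 2 * n)%N.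
Proof.
set S := [set _ | _]%SET.
have lt (p : 'I_(W + n) * 'I_n) : (p.1 + p.2 < W + 2 * n)%N.
  by have := ltn_ord p.1; have := ltn_ord p.2; lia.
have <- : #|finset.setX S [set: 'I_n]%SET| = (#|S| * n)%N by rewrite cardsX cardsT card_ord.
rewrite -[leqRHS]card_ord -(card_in_imset (f := fun p => Ordinal (lt p))).
  exact: max_card.
move=> [s i] [s' i']; rewrite !inE !andbT /= => hs hs' /(congr1 val)/= e.
have ss' : (s : nat)%:Z - n%:Z = (s' : nat)%:Z - n%:Z.
  apply: (@block_start_inj x); [lra|lra|].
  by have := ltn_ord i; have := ltn_ord i'; lia.
by congr pair; apply: val_inj => /=; lia.
Qed.

(** Each pair of a block start and a function positive there accounts for at most one coordinate. *)
Lemma card_undecided_cells (k W : nat) x : 0 <= d ->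
  #|[set m : 'I_k * 'I_W | [exists i : 'I_n, (1 / 2 <= v (T x ((m.2 : nat)%:Z - i%:Z))) &&
      ~~ all_decided (cell_bits m.1 i (T x (m.2 : nat)%:Z))]]%SET|%:R
    <= d * (W + 2 * n)%:R.
Proof.
move=> d0.
pose S := [set s : 'I_(W + n) | 1 / 2 <= v (T x ((s : nat)%:Z - n%:Z))]%SET.
pose y (s : 'I_(W + n)) := T x ((s : nat)%:Z - n%:Z).
pose A0 := [set p : 'I_(W + n) * A | (p.1 \in S) && (0 < w p.2 (y p.1))]%SET.
pose kill (m : 'I_k * 'I_W) (p : 'I_(W + n) * A) :=
  [exists i : 'I_n, (m.2 + n == p.1 + i)%N &&
    ~~ decided (bit (k * n) (m.1 * n + i) (w p.2 (y p.1)))].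
apply: (@le_trans _ _ #|A0|%:R).
  rewrite ler_nat; apply: leq_trans (card_killed (kill := kill) _ _).
    apply: subset_leq_card; apply/fintype.subsetP => -[j z]; rewrite !inE /=.
    move=> /existsP[i /andP[vi]]; rewrite negb_forall => /existsP[a].
    rewrite cell_bits_translate => h.
    have lt : (z + n - i < W + n)%N by have := ltn_ord z; have := ltn_ord i; lia.
    have es : ((z + n - i)%N%:Z - n%:Z) = (z : nat)%:Z - i%:Z by have := ltn_ord i; lia.
    have yE : y (Ordinal lt) = T x ((z : nat)%:Z - i%:Z) by rewrite /y /= es.
    apply/existsP; exists (Ordinal lt, a); rewrite /kill !inE/= es vi yE.
    have /andP[-> _] := bit_undecided_itv (index_ltn j i) h.
    by apply/existsP; exists i; rewrite h andbT; apply/eqP; have := ltn_ord i; lia.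
  move=> [j z] [j' z'] [s a]; rewrite /kill/=.
  move=> /existsP[i /andP[/eqP ei h]] /existsP[i' /andP[/eqP ei' h']].
  have [e1 e2] := muln_addn_inj (ltn_ord i) (ltn_ord i') (bit_undecided_inj h h').
  by congr pair; apply: val_inj => //=; lia.
have -> : #|A0| = (\sum_(s in S) #|[set a | (0 < w a (y s))%R]%SET|)%N.
  rewrite -sum1_card (eq_bigl (fun p : 'I_(W + n) * A => (p.1 \in S) && (0 < w p.2 (y p.1)))).
    rewrite -(pair_big_dep (mem S) (fun s a => 0 < w a (y s)) (fun _ _ => 1%N))/=.
    by apply: eq_bigr => s _; rewrite sum1dep_card.
  by move=> p; rewrite inE.
rewrite natr_sum; apply: (@le_trans _ _ (\sum_(s in S) (d * n%:R))); first exact: ler_sum.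
rewrite sumr_const -[leLHS]mulr_natr -mulrA ler_wpM2l// -natrM ler_nat mulnC.
exact: card_block_starts.
Qed.

Section Boundary.
Variables (C : finType) (beta : C -> X -> R).
Hypothesis beta01 : forall c x, 0 <= beta c x <= 1.
Hypothesis beta_cover : forall x, exists c, beta c x = 1.

Definition level (i : 'I_n) (x : X) : R := Num.max 0 (2 * v (T x (- i%:Z)) - 1).

(** Inside the tower these functions name the phase, elsewhere a small set; the bound by
    [1 - \sum_i level i x] turns the small sets off inside. Values strictly between 0 and 1 can only
    occur away from blocks with [v = 1]. *)
Definition boundary_cover (b : 'I_n + C) (x : X) : R :=
  match b with
  | inl i => level i x
  | inr c => Num.min (beta c x) (1 - \sum_i level i x)
  end.

Lemma level_gt0 i x : 0 < level i x -> 1 / 2 < v (T x (- i%:Z)).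
Proof. by rewrite lt_max ltxx/=; lra. Qed.

Lemma level_inj i i' x : 0 < level i x -> 0 < level i' x -> i = i'.
Proof.
move=> /level_gt0 h /level_gt0 h'; apply: val_inj.
have lt := dist_opp_ord i i'.
have : - i%:Z = - i'%:Z by apply: (@block_start_inj x) => //; lra.
by move=> /oppr_inj [].
Qed.

Lemma level_ge0 i x : 0 <= level i x. Proof. by rewrite le_max lexx. Qed.

Lemma sum_level i x : 0 < level i x -> \sum_i level i x = level i x.
Proof.
move=> h; rewrite (bigD1 i)//= big1 ?addr0// => i' i'i.
apply/eqP; rewrite eq_le level_ge0 andbT leNgt; apply: contra i'i => h'.
by rewrite (level_inj h h').
Qed.

Lemma boundary_cover_ge x : exists b, 1 / 2 <= boundary_cover b x.
Proof.
have [c hc] := beta_cover x.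
have [[i hi]|no] := pselect (exists i, 0 < level i x).
  have [h|h] := leP (1 / 2) (level i x); first by exists (inl i).
  by exists (inr c) => /=; rewrite hc (sum_level hi) le_min; apply/andP; split; lra.
exists (inr c) => /=; rewrite hc big1 => [|i _].
  by rewrite le_min; apply/andP; split; lra.
by apply/eqP; rewrite eq_le level_ge0 andbT leNgt; apply/negP => h; apply: no; exists i.
Qed.

Lemma boundary_cover_deep b (i : 'I_n) x : v (T x (- i%:Z)) = 1 ->
  ~~ (0 < boundary_cover b x < 1).
Proof.
move=> vi; have li : level i x = 1.
  by rewrite /level vi (max_idPr _); lra.
have l0 : 0 < level i x by rewrite li.
case: b => [i'|c] /=.
  have [e|ne] := eqVneq i' i; first by rewrite e li ltxx andbF.
  apply/negP => /andP[h _]; move/negP: ne; apply; apply/eqP; exact: level_inj h l0.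
by rewrite (sum_level l0) li subrr lt_min ltxx !andbF.
Qed.

(** A coordinate does not know its place in the window, so it encodes the present and the [W - 1]
    preceding times. Read at time [m], the entry with [p.1 = m] describes the point at time 0. *)
Definition boundary_bits (k W : nat) (j : 'I_k) (x : X) (p : 'I_W * ('I_n + C)) : R :=
  bit (k * W) (j * W + p.1) (boundary_cover p.2 (T x (- (p.1 : nat)%:Z))).

Lemma card_undecided_boundary (k W : nat) (e : R) x :
  (forall x, #|[set tau : 'I_(2 * W) |
      [forall i : 'I_n, v (T x (tau%:Z - i%:Z)) < 1]]%SET|%:R <= e * (2 * W)%:R) ->
  #|[set m : 'I_k * 'I_W | ~~ all_decided (@boundary_bits k W m.1 (T x (m.2 : nat)%:Z))]%SET|%:R
    <= e * (2 * W)%:R * (n + #|C|)%:R.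
Proof.
move=> he.
(* Moving the base point by [- W] turns the times that are read, before and inside the window, into
   natural numbers below [2 * W]. *)
pose x' := T x (- W%:Z).
pose S := [set tau : 'I_(2 * W) | [forall i : 'I_n, v (T x' (tau%:Z - i%:Z)) < 1]]%SET.
pose A0 := finset.setX S [set: 'I_n + C]%SET.
pose kill (m : 'I_k * 'I_W) (p : 'I_(2 * W) * ('I_n + C)) :=
  [exists b : 'I_W, (m.2 + W == p.1 + b)%N &&
    ~~ decided (bit (k * W) (m.1 * W + b) (boundary_cover p.2 (T x' (p.1 : nat)%:Z)))].
apply: (@le_trans _ _ #|A0|%:R); last first.
  rewrite cardsX cardsT card_sum card_ord natrM ler_wpM2r//; exact: he.
rewrite ler_nat; apply: leq_trans (card_killed (kill := kill) _ _).
  apply: subset_leq_card; apply/fintype.subsetP => -[j z]; rewrite !inE /=.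
  rewrite negb_forall => /existsP[[b c]]; rewrite /boundary_bits/= -int_actD => h.
  have lt : (z + W - b < 2 * W)%N by have := ltn_ord z; have := ltn_ord b; lia.
  have ex : T x ((z : nat)%:Z - (b : nat)%:Z) = T x' (z + W - b)%N%:Z.
    by rewrite /x' -int_actD; congr (T x _); have := ltn_ord b; lia.
  rewrite ex in h.
  apply/existsP; exists (Ordinal lt, c); rewrite !inE andbT; apply/andP; split.
    apply/forallP => i; rewrite lt_neqAle; have /andP[_ ->] := v01 (T x' ((Ordinal lt : nat)%:Z - i%:Z)).
    rewrite andbT; apply/eqP => vi.
    have vi' : v (T (T x' (z + W - b)%N%:Z) (- i%:Z)) = 1 by rewrite -int_actD.
    have /negP := boundary_cover_deep c vi'; apply.
    exact: bit_undecided_itv (index_ltn j b) h.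
  by apply/existsP; exists b; rewrite h andbT; apply/eqP => /=; have := ltn_ord b; lia.
move=> [j z] [j' z'] [s a]; rewrite /kill/=.
move=> /existsP[i /andP[/eqP ei h]] /existsP[i' /andP[/eqP ei' h']].
have [e1 e2] := muln_addn_inj (ltn_ord i) (ltn_ord i') (bit_undecided_inj h h').
by congr pair; apply: val_inj => //=; lia.
Qed.

End Boundary.
End Counting.

(** * Perturbation to maps of small multiplicity *)

Lemma uniformly_continuous {R : realType} {X : metricType R} (h : X -> R) (e : R) :
  compact [set: X] -> continuous h -> 0 < e ->
  exists2 del, 0 < del & forall x y, mdist x y < del -> `|h x - h y| <= e.
Proof.
move=> cX /continuous_mdistP ch e0.
have e2 : 0 < e / 2 by rewrite divr_gt0.
have /choice[r hr] : forall x, exists r, 0 < r /\ forall y, mdist x y < r -> `|h x - h y| < e / 2.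
  by move=> x; have [r r0 hr] := ch x _ e2; exists r.
have r2 x : 0 < r x / 2 by rewrite divr_gt0// (hr x).1.
have [rho rho0 hrho] := lebesgue_number cX r2; exists rho => // x y xy.
have [c cx rc] := hrho x.
have r0 := r2 c.
have := (hr c).2 x _; have := (hr c).2 y _.
have := metric_triangle c x y => tr.
move=> /(_ ltac:(lra)) h1 /(_ ltac:(lra)) h2.
have := ler_normD (h c - h y) (h x - h c); rewrite (distrC (h x) (h c)).
by rewrite (_ : h c - h y + (h x - h c) = h x - h y); [lra|ring].
Qed.

Section Perturbation.
Context {R : realType} {X : metricType R} (T : int_action X) (k : nat).
Implicit Types h g : X -> 'I_k -> R.

Definition cube_valued h :=
  (forall j, continuous (h^~ j)) /\ forall x j, 0 <= h x j <= 1.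

(** The margin [del] is uniform over all tuples, so the property survives small uniform changes of
    [g]. *)
Definition no_multiple_orbit (r : nat) (eta : R) g (del : R) :=
  forall xs : 'I_r -> X, (forall l l', l != l' -> eta <= mdist (xs l) (xs l')) ->
    exists l l' z j, 2 * del < `|g (T (xs l) z) j - g (T (xs l') z) j|.

Hypothesis cX : compact [set: X].

Lemma perturbation_free (p : X) (d : R) (a : nat) h (eps eta : R) :
  minimal T -> (forall x i, 0 < i -> T x i <> x) ->
  0 < d -> mdim_le_minus T d -> (0 < a)%N -> k%:R < a.+1%:R * (k%:R - d) ->
  cube_valued h -> 0 < eps -> 0 < eta ->
  exists g del, [/\ 0 < del, cube_valued g, forall x j, `|g x j - h x j| <= eps &
    no_multiple_orbit (a * a).+1 eta g del].
Proof.
move=> minT freeT d0 hd a0 kd [ch h01] eps0 eta0.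
have eps2 : 0 < eps / 2 by rewrite divr_gt0.
have /choice[eta1 heta1] : forall j, exists e1, 0 < e1 /\
    forall x y, mdist x y < e1 -> `|h x j - h y j| <= eps / 2.
  by move=> j; have [e1 e10 he1] := uniformly_continuous cX (ch j) eps2; exists e1.
(* Being below [eta], it makes sharing a cell contradict separation; being below [eta1 j], it bounds
   the variation of [h] on cells, as [coding] requires. *)
pose eta' := \big[Num.min/eta]_j eta1 j.
have eta'0 : 0 < eta' by apply/bigmin_gtP; split=> // j _; exact: (heta1 j).1.
have eta'eta : eta' <= eta by exact: bigmin_le_id.
have heta' x y j : mdist x y < eta' -> `|h x j - h y j| <= eps / 2.
  by move=> lt; apply: (heta1 j).2; apply: lt_le_trans lt _; exact: bigmin_le_cond.
have [A [n [w [n0 cw w01 wcov [wcard wclose]]]]] := mdim_cover_functions cX p d0 hd eta'0.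
have eta4 : 0 < eta / 4 by rewrite divr_gt0.
have [s hs] := compact_finite_balls cX (fun _ : X => eta4).
pose C : finType := seq_sub s.
(* These functions are 1 on the covering balls of radius [eta / 4] and vanish from distance
   [eta / 2] on, so two points at which one of them is positive are closer than [eta]. *)
pose beta (c : C) x := clamp (2 - mdist (ssval c) x / (eta / 4)).
have beta01 c x : 0 <= beta c x <= 1 by exact: clamp_itv.
have beta_cover x : exists c, beta c x = 1.
  have [c cs cx] := hs x; exists (SeqSub cs); rewrite /beta /clamp /=.
  have : mdist c x / (eta / 4) <= 1 by rewrite ler_pdivrMr// mul1r ltW.
  by move=> le1; rewrite (min_idPl _) ?(max_idPr _)//; lra.
have beta_gt0 c x : 0 < beta c x -> mdist (ssval c) x < eta / 2.
  rewrite lt_max ltxx/= lt_min => /andP[_].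
  by rewrite subr_gt0 ltr_pdivrMr//; lra.
have cdist q : continuous (fun x : X => mdist q x).
  apply/continuous_mdistP => x e e0; exists e => // y xy.
  have := metric_triangle q x y; have := metric_triangle q y x.
  rewrite (metric_sym y x) => ? ?.
  by rewrite ltr_norml; apply/andP; split; lra.
have cbeta c : continuous (beta c).
  apply: continuous_clamp => x; apply: cvgB; first exact: cvg_cst.
  by apply: cvgM; [exact: cdist|exact: cvg_cst].
(* The slack of the counting inequality per unit of time. Half of it pays, through [e], for the gaps
   of the tower; the other half pays, through [W1], for the ends of the window. *)
pose sig := a.+1%:R * (k%:R - d) - k%:R.
have sig0 : 0 < sig by rewrite subr_gt0.
pose N := (n + #|C|)%N.
pose e := sig / (2 * (a.+1%:R * (k%:R + 2 * N%:R + 1))).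
have den0 : 0 < a.+1%:R * (k%:R + 2 * N%:R + 1) :> R.
  by rewrite mulr_gt0// ltr_wpDl// addr_ge0// mulr_ge0.
have e0 : 0 < e by rewrite divr_gt0// mulr_gt0.
have eE : a.+1%:R * (e * (k%:R + 2 * N%:R + 1)) = sig / 2.
  rewrite mulrCA /e; move: den0; move: (a.+1%:R * _) => D D0.
  by field; rewrite gt_eqF.
have [v [W0 [cv v01 vdisj vdense]]] := tower cX minT freeT p n0 e0.
pose W1 := `|Num.ceil (4 * a.+1%:R * n%:R * d / sig)|.+1%N.
pose W := maxn W0 W1.
have WW0 : (W0 <= W)%N by exact: leq_maxl.
have W0' : (0 < W)%N by rewrite (@leq_trans W1)// leq_maxr.
have hW : 4 * a.+1%:R * n%:R * d < sig * W%:R.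
  rewrite [sig * _]mulrC -ltr_pdivrMr//.
  have lt : (Num.ceil (4 * a.+1%:R * n%:R * d / sig))%:~R < (W%:Z)%:~R :> R.
    by rewrite ltr_int (@lt_le_trans _ _ W1%:Z) ?lez_nat ?leq_maxr// /W1; clear; lia.
  exact: le_lt_trans (ceil_ge _) lt.
pose P (i : 'I_n) x := clamp (2 * v (T x (- i%:Z))).
have P1 i x : (P i x = 1) <-> (1 / 2 <= v (T x (- i%:Z))).
  rewrite /P /clamp; split=> [h1|h1]; last by rewrite (min_idPl _) ?(max_idPr _)//; lra.
  have : 1 <= Num.min 1 (2 * v (T x (- i%:Z))).
    by move: h1; rewrite /Num.max; case: ifP => [_ ->//|_ /eqP]; rewrite eq_sym oner_eq0.
  by rewrite le_min => /andP[_]; lra.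
have P01 i i' x : P i x = 1 -> i' != i -> P i' x = 0.
  move=> /P1 h1 ne; rewrite /P /clamp (max_idPl _)// ge_min; apply/orP; right.
  suff : v (T x (- i'%:Z)) <= 0 by lra.
  rewrite leNgt; apply: contra ne => h2; apply/eqP/val_inj.
  have lt := dist_opp_ord i i'.
  have vi0 : 0 < v (T x (- i%:Z)) by lra.
  by have [ii'] := oppr_inj (block_start_inj vdisj vi0 h2 lt); exact: esym ii'.
have cshift z (f : X -> R) : continuous f -> continuous (fun x => f (T x z)).
  by move=> cf; exact: continuous_translate.
have clevel i : continuous (level T v i).
  apply: continuous_maxr; first exact: continuous_cst.
  move=> x; apply: cvgB; last exact: cvg_cst.
  by apply: cvgM; [exact: cvg_cst|exact: (cshift (- i%:Z) v)].
have cbc b : continuous (boundary_cover T v beta (n := n) b).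
  case: b => [i|c] /=; first exact: clevel.
  apply: continuous_minr; first exact: cbeta.
  move=> x; apply: cvgB; first exact: cvg_cst.
  by apply: (continuous_sum (h := fun i x => level T v i x)) => i; exact: clevel.
(* Some function is 1 at the block start of [x]. Its bit is then 1 for [x], hence for [y], so it is
   positive at both starts and [wclose] applies along the whole block. *)
have cellcl (j : 'I_k) (i : 'I_n) x y :
    all_decided (cell_bits T w j i x) -> all_decided (cell_bits T w j i y) ->
    code (cell_bits T w j i x) = code (cell_bits T w j i y) ->
    forall i' : 'I_n, mdist (T x (i'%:Z - i%:Z)) (T y (i'%:Z - i%:Z)) < eta'.
  move=> dx dy /ffunP cxy i'.
  have [b hb] := wcov (T x (- i%:Z)).
  have bx : cell_bits T w j i x b = 1.
    by rewrite /cell_bits hb bit_ge//; [exact: index_ltn|lra].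
  have := cxy b; rewrite !ffunE bx eqxx => /esym/eqP by1.
  rewrite addrC !int_actD; apply: (wclose b); rewrite ?hb//.
  rewrite ltNge; apply/negP => le0; move: by1; rewrite /cell_bits bit_le0//.
  by move/eqP; rewrite eq_sym oner_eq0.
have hcod (j : 'I_k) := @coding R X 'I_n A ('I_W * ('I_n + C))%type P
  (cell_bits T w j) (boundary_bits T v beta j (n := n) (W := W)) (h^~ j) eps eps0 (ch j)
  (fun x => h01 x j).
pose good_coding (j : 'I_k) (gd : ((X -> R) * R)%type) :=
  [/\ 0 < gd.2, continuous gd.1, forall x, 0 <= gd.1 x <= 1,
    forall x, `|gd.1 x - h x j| <= eps &
    forall i i' x y, P i x = 1 -> P i' y = 1 ->
      all_decided (cell_bits T w j i x) -> all_decided (cell_bits T w j i' y) ->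
      `|gd.1 x - gd.1 y| <= 2 * gd.2 ->
      [/\ i = i', code (cell_bits T w j i x) = code (cell_bits T w j i' y) &
          all_decided (boundary_bits T v beta j (n := n) (W := W) x) ->
          all_decided (boundary_bits T v beta j (n := n) (W := W) y) ->
          code (boundary_bits T v beta j (n := n) (W := W) x) =
          code (boundary_bits T v beta j (n := n) (W := W) y)]].
have /choice[gd hgd] : forall j : 'I_k, exists gd, good_coding j gd.
  move=> j; have [|||||g [del hg]] := hcod j; last by exists (g, del).
  - move=> i; apply: continuous_clamp => x; apply: cvgM; first exact: cvg_cst.
    exact: (cshift (- i%:Z) v).
  - exact: P01.
  - by move=> i b; apply: continuous_bit; exact: (cshift (- i%:Z) (w b)).
  - by move=> [b c]; apply: continuous_bit; exact: (cshift (- (b : nat)%:Z)).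
  - move=> i x y _ _ dx dy cxy; apply: heta'.
    by have := cellcl j i x y dx dy cxy i; rewrite subrr !int_act0.
pose g x j := (gd j).1 x.
pose del := \big[Num.min/1]_j (gd j).2.
exists g, del.
have del0 : 0 < del by apply/bigmin_gtP; split=> // j _; case: (hgd j).
split => //.
- split=> [j|x j]; first by have [_ + _ _ _] := hgd j; exact.
  by have [_ _ + _ _] := hgd j; exact.
- by move=> x j; have [_ _ _ + _] := hgd j; exact.
have hg j i i' x y : P i x = 1 -> P i' y = 1 ->
      all_decided (cell_bits T w j i x) -> all_decided (cell_bits T w j i' y) ->
      `|g x j - g y j| <= 2 * del ->
      [/\ i = i', code (cell_bits T w j i x) = code (cell_bits T w j i' y) &
          all_decided (boundary_bits T v beta j (n := n) (W := W) x) ->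
          all_decided (boundary_bits T v beta j (n := n) (W := W) y) ->
          code (boundary_bits T v beta j (n := n) (W := W) x) =
          code (boundary_bits T v beta j (n := n) (W := W) y)].
  move=> Px Py dx dy gxy; have [_ _ _ _] := hgd j; apply => //.
  apply: le_trans gxy _; rewrite ler_pM2l//; exact: bigmin_le_cond.
move=> xs sep; apply: contrapT => no.
have same l l' z j : `|g (T (xs l) z) j - g (T (xs l') z) j| <= 2 * del.
  by rewrite leNgt; apply/negP => lt; apply: no; exists l, l', z, j.
(* The key is the phase at time 0; a point at which no level is positive gets its own index and
   shares its key with no other. *)
pose key l : 'I_n + 'I_(a * a).+1 :=
  if [pick i | 0 < level T v i (xs l)] is Some i then inl i else inr l.
have [[c [phi [injphi hphi]]]|[phi injphi]] := pigeonhole_square key (ltnSn (a * a)).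
  (* A key shared by [a + 1 >= 2] indices must be a phase; [Ordinal n0] only fills the impossible
     branch. *)
  have [i hi] : exists i : 'I_n, forall l, 0 < level T v i (xs (phi l)).
    have h0 l : key (phi l) = inl (match c with inl i => i | inr _ => Ordinal n0 end) ->
       0 < level T v (match c with inl i => i | inr _ => Ordinal n0 end) (xs (phi l)).
      by rewrite /key; case: pickP => // i hi [<-].
    case: c hphi h0 => [i|l] hphi h0; first by exists i => l; apply: h0; exact: hphi.
    exfalso; have e1 (l' : 'I_a.+1) : phi l' = l.
      by have := hphi l'; rewrite /key; case: pickP => // _ [].
    have /injphi/(congr1 val)/= e2 : phi ord0 = phi ord_max by rewrite !e1.
    by move: a0; rewrite -e2.
  pose u l := T (xs (phi l)) (- i%:Z).
  (* The blocks of these points all start at time [- i]. A common decided coordinate would put two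
     points in the same cell, hence closer than [eta] at time 0. *)
  pose F l := [set m : 'I_k * 'I_n | all_decided (cell_bits T w m.1 m.2 (T (u l) (m.2 : nat)%:Z))]%SET.
  have FC l : #|~: F l|%:R <= d * n%:R.
    apply: le_trans (card_undecided_in_block T wcard k (u l)).
    rewrite ler_nat; apply: subset_leq_card; apply/fintype.subsetP => m.
    by rewrite !inE.
  have Fbig : #|{: 'I_k * 'I_n}|%:R < a.+1%:R * (#|{: 'I_k * 'I_n}|%:R - d * n%:R).
    by rewrite card_prod !card_ord natrM -mulrBl mulrA ltr_pM2r// ltr0n.
  have [l [l' [[j i'] [ll']]]] := card_disjoint_family_lt FC Fbig.
  rewrite !inE/= => dl dl'.
  have Pu l0 : P i' (T (u l0) i'%:Z) = 1.
    apply/P1; rewrite -int_actD subrr int_act0; apply: ltW.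
    exact: level_gt0 (hi l0).
  have := hg j i' i' _ _ (Pu l) (Pu l') dl dl'.
  rewrite /u -!int_actD => /(_ (same _ _ _ _))[_ cc _].
  rewrite /u -!int_actD in dl dl'.
  have := cellcl j i' _ _ dl dl' cc i.
  rewrite -!int_actD (_ : - i%:Z + i'%:Z + (i%:Z - i'%:Z) = 0); last by ring.
  rewrite !int_act0 ltNge => /negP; apply; apply: le_trans eta'eta _.
  by apply: sep; apply: contra ll' => /eqP/injphi->.
(* With different keys, the coordinates of the long window are counted at which the phase, the cell
   and the boundary bits can all be read. *)
pose F l := [set m : 'I_k * 'I_W |
  [exists i, (P i (T (xs (phi l)) (m.2 : nat)%:Z) == 1) &&
     all_decided (cell_bits T w m.1 i (T (xs (phi l)) (m.2 : nat)%:Z))] &&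
  all_decided (boundary_bits T v beta m.1 (n := n) (W := W) (T (xs (phi l)) (m.2 : nat)%:Z))]%SET.
have WW : (W0 <= 2 * W)%N by rewrite (leq_trans WW0)// leq_pmull.
(* The three terms bound the gaps of the tower, the undecided cell bits and the undecided boundary
   bits. *)
have FC l : #|~: F l|%:R <= k%:R * (e * W%:R) + d * (W + 2 * n)%:R + e * (2 * W)%:R * N%:R.
  pose x := xs (phi l).
  pose B0 := [set tau : 'I_W | [forall i : 'I_n, v (T x (tau%:Z - i%:Z)) < 1]]%SET.
  pose B1 := finset.setX [set: 'I_k]%SET B0.
  pose B2 := [set m : 'I_k * 'I_W | [exists i : 'I_n, (1 / 2 <= v (T x ((m.2 : nat)%:Z - i%:Z))) &&
      ~~ all_decided (cell_bits T w m.1 i (T x (m.2 : nat)%:Z))]]%SET.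
  pose B3 := [set m : 'I_k * 'I_W |
    ~~ all_decided (boundary_bits T v beta (n := n) (W := W) m.1 (T x (m.2 : nat)%:Z))]%SET.
  have b1 : #|B1|%:R <= k%:R * (e * W%:R).
    by rewrite cardsX cardsT card_ord natrM ler_wpM2l//; exact: (vdense W WW0 x).
  have b2 : #|B2|%:R <= d * (W + 2 * n)%:R by apply: card_undecided_cells => //; exact: ltW.
  have b3 : #|B3|%:R <= e * (2 * W)%:R * N%:R.
    by apply: card_undecided_boundary => // y; exact: (vdense _ WW y).
  apply: (@le_trans _ _ (#|B1| + #|B2| + #|B3|)%N%:R); last by rewrite [leLHS]natrD lerD// [leLHS]natrD lerD.
  rewrite ler_nat; apply: leq_trans (_ : #|B1 :|: B2 :|: B3| <= _)%N; last first.
    by apply: leq_trans (leq_card_setU _ _) _; rewrite leq_add2r; exact: leq_card_setU.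
  apply: subset_leq_card; apply/fintype.subsetP => -[j z]; rewrite !inE/= -/x negb_and.
  move=> /orP[/existsPn hP|->]; last by rewrite orbT.
  have [/forallP h1|/forallPn[i hi]] := boolP [forall i : 'I_n, v (T x ((z : nat)%:Z - i%:Z)) < 1 / 2].
    by apply/orP; left; apply/orP; left; apply/forallP => i; have := h1 i; lra.
  rewrite -leNgt in hi.
  apply/orP; left; apply/orP; right; apply/existsP; exists i; rewrite hi/=.
  have := hP i; rewrite negb_and => /orP[/eqP|//]; case; apply/P1.
  by rewrite -int_actD.
have Fbig : #|{: 'I_k * 'I_W}|%:R < a.+1%:R * (#|{: 'I_k * 'I_W}|%:R -
     (k%:R * (e * W%:R) + d * (W + 2 * n)%:R + e * (2 * W)%:R * N%:R)).
  have E1 : a.+1%:R * (e * (k%:R + 2 * N%:R + 1)) * W%:R = sig / 2 * W%:R by rewrite eE.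
  have E2 : 0 <= a.+1%:R * e * W%:R by rewrite !mulr_ge0// ltW.
  rewrite card_prod !card_ord [(k * W)%:R]natrM [(2 * W)%:R]natrM [(W + 2 * n)%:R]natrD [(2 * n)%:R]natrM.
  have E3 : sig * W%:R = a.+1%:R * (k%:R - d) * W%:R - k%:R * W%:R by rewrite /sig mulrBl.
  move: hW E1 E2 E3; clear.
  move: (e) (a.+1%:R : R) (sig) (W%:R : R) (k%:R : R) (n%:R : R) (N%:R : R) => e' a' s' W' k' n' N'.
  lra.
have [l [l' [[j z] [ll']]]] := card_disjoint_family_lt FC Fbig.
rewrite !inE/= => /andP[/existsP[i /andP[/eqP Pi di]] dbl].
move=> /andP[/existsP[i' /andP[/eqP Pi' di']] dbl'].
have [_ _ /(_ dbl dbl')/ffunP cc] := hg j i i' _ _ Pi Pi' di di' (same _ _ _ _).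
(* The boundary codes agree and their entry [(z, b)] reads time 0, so a function that is at least
   1/2 at one point is positive at the other. A phase would make the keys equal; a small set would
   bring the points closer than [eta]. *)
have [b hb] := boundary_cover_ge vdisj beta_cover (xs (phi l)).
have xE l0 : boundary_bits T v beta j (n := n) (W := W) (T (xs (phi l0)) (z : nat)%:Z) (z, b) =
    bit (k * W) (j * W + z) (boundary_cover T v beta b (xs (phi l0))).
  by rewrite /boundary_bits/= -int_actD subrr int_act0.
have := cc (z, b); rewrite !ffunE !xE bit_ge ?index_ltn// eqxx => /esym/eqP hb'.
have {}hb' : 0 < boundary_cover T v beta b (xs (phi l')).
  rewrite ltNge; apply/negP => le0; move: hb'; rewrite bit_le0//.
  by move/eqP; rewrite eq_sym oner_eq0.
have {}hb : 0 < boundary_cover T v beta b (xs (phi l)) by apply: lt_le_trans hb; lra.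
case: b hb hb' {xE} => [i0|c] /=.
  move=> h1 h2; move/negP: ll'; apply; apply/eqP; apply: injphi => /=.
  have keyE l0 : 0 < level T v i0 (xs (phi l0)) -> key (phi l0) = inl i0.
    move=> h3; rewrite /key; case: pickP => [i1 h4|/(_ i0)]; last by rewrite h3.
    by congr inl; exact: level_inj h4 h3.
  by rewrite !keyE.
rewrite !lt_min => /andP[/beta_gt0 h1 _] /andP[/beta_gt0 h2 _].
have : eta <= mdist (xs (phi l)) (xs (phi l')).
  by apply: sep; apply: contra ll' => /eqP e1; apply/eqP/injphi => /=; rewrite e1.
have := metric_triangle (xs (phi l)) (ssval c) (xs (phi l')).
rewrite (metric_sym (xs (phi l)) (ssval c)); lra.
Qed.

End Perturbation.

(** * Periodic points and finite systems *)

Section Finite.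
Context {R : realType} {X : metricType R} (T : int_action X).

Lemma periodic_orbit p (i : nat) (q : int) : T p i%:Z = p -> T p (q * i%:Z) = p.
Proof.
move=> Tp; have Tn (m : nat) : T p (m%:Z * i%:Z) = p.
  elim: m => [|m IH]; first by rewrite mul0r int_act0.
  by rewrite -addn1 PoszD mulrDl mul1r int_actD IH.
case: q => m; first exact: Tn.
have -> : Negz m * i%:Z = - (m.+1%:Z * i%:Z) by rewrite NegzE mulNr.
by rewrite -{1}(Tn m.+1) -int_actD subrr int_act0.
Qed.

Lemma min_dist_gt0 (s : seq X) x : 0 < \big[Num.min/1]_(c <- s | c != x) mdist x c :> R.
Proof.
elim/big_ind: _ => // [y z y0 z0|c cx]; first by rewrite lt_min y0.
by rewrite mdist_gt0 eq_sym.
Qed.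

Lemma min_dist_le (s : seq X) x c : c \in s -> c != x ->
  \big[Num.min/1]_(c <- s | c != x) mdist x c <= mdist x c :> R.
Proof.
move=> cs cx; elim: s cs => // b s IH; rewrite inE big_cons => /orP[/eqP<-|/IH h].
  by rewrite cx ge_min lexx.
by case: ifP => // _; rewrite ge_min h orbT.
Qed.

(** The finite orbit of [p] is dense, while a point outside of it would have a ball avoiding it. *)
Lemma minimal_periodic_finite p (i : nat) : minimal T -> (0 < i)%N -> T p i%:Z = p ->
  exists s : seq X, forall x, x \in s.
Proof.
move=> minT i0 Tp; pose s := [seq T p (j : nat)%:Z | j <- iota 0 i].
have ps t : T p t \in s.
  have i0' : 0 < i%:Z by [].
  rewrite (divz_eq t i) int_actD periodic_orbit//.
  have r0 : 0 <= (t %% i%:Z)%Z by rewrite modz_ge0 ?gt_eqF.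
  have ri := ltz_pmod t i0'.
  have [r er] : exists r : nat, (t %% i%:Z)%Z = r%:Z by exists `|(t %% i%:Z)%Z|%N; lia.
  by apply/mapP; exists r; rewrite ?er// mem_iota; move: ri; rewrite er; lia.
exists s => x; apply: contrapT => /negP xs.
have [||y [/= yx [t _ ty]]] := @minT p (interior (ball x (\big[Num.min/1]_(c <- s | c != x) mdist x c : R))).
- by exists x; apply: nbhsx_ballx; exact: min_dist_gt0.
- exact: open_interior.
move/interior_subset: yx; rewrite -ty ballEmdist/= ltNge => /negP; apply.
by apply: min_dist_le => //; apply: contra xs => /eqP<-.
Qed.

Lemma finite_metric_continuous (s : seq X) (h : X -> R) : (forall x, x \in s) -> continuous h.
Proof.
move=> hs; apply/continuous_mdistP => x e e0.
exists (\big[Num.min/1]_(c <- s | c != x) mdist x c); first exact: min_dist_gt0.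
move=> y xy; have [->|yx] := eqVneq y x; first by rewrite subrr normr0.
by have := min_dist_le (hs y) yx; rewrite leNgt xy.
Qed.

Lemma perturbation_finite (k r : nat) (s : seq X) (h : X -> 'I_k -> R) (eps eta : R) :
  (forall x, x \in s) -> (0 < k)%N -> (1 < r)%N ->
  cube_valued h -> 0 < eps -> 0 < eta ->
  exists g del, [/\ 0 < del, cube_valued g, forall x j, `|g x j - h x j| <= eps &
    no_multiple_orbit T r eta g del].
Proof.
move=> hs k0 r1 [ch h01] eps0 eta0.
pose el x : seq_sub s := SeqSub (hs x).
have /choice[gd hgd] : forall j : 'I_k, exists vg : ((seq_sub s -> R) * R)%type,
    [/\ 0 < vg.2 <= eps, forall e, `|vg.1 e - h (ssval e) j| <= eps,
      forall e, 0 <= vg.1 e /\ vg.1 e + vg.2 <= 1 &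
      forall e e', e != e' -> 2 * vg.2 <= `|vg.1 e - vg.1 e'| ].
  move=> j; have [val [gam hvg]] := separated_values eps0 (fun e : seq_sub s => h01 (ssval e) j).
  by exists (val, gam).
pose j0 := Ordinal k0.
have [/andP[g0 _] _ _ sep] := hgd j0.
exists (fun x j => (gd j).1 (el x)), ((gd j0).2 / 2); split.
- by rewrite divr_gt0.
- split=> [j|x j]; first exact: finite_metric_continuous hs.
  have [/andP[gj0 _] _ /(_ (el x))[v0 v1] _] := hgd j.
  by rewrite v0; lra.
- by move=> x j; have [_ /(_ (el x))] := hgd j.
move=> xs hxs; pose l0 : 'I_r := Ordinal (ltnW r1); pose l1 : 'I_r := Ordinal r1.
exists l0, l1, 0, j0; rewrite !int_act0.
apply: (@lt_le_trans _ _ (2 * (gd j0).2)); first lra.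
apply: sep; apply/eqP => /(congr1 (@ssval _ _)) /= e.
by have := hxs l0 l1 isT; rewrite e mdistxx leNgt eta0.
Qed.

End Finite.

(** * The Baire argument *)

Section Baire.
Context {R : realType} {X : metricType R} (T : int_action X).
Hypothesis cX : compact [set: X].
Hypothesis minT : minimal T.

(** Either the space is empty, or a periodic point makes the system finite, or the action is
    free. *)
Lemma perturbation (d : R) (k a : nat) (h : X -> 'I_k -> R) (eps eta : R) :
  0 < d -> mdim_le_minus T d -> (0 < a)%N -> (0 < k)%N -> k%:R < a.+1%:R * (k%:R - d) ->
  cube_valued h -> 0 < eps -> 0 < eta ->
  exists g del, [/\ 0 < del, cube_valued g, forall x j, `|g x j - h x j| <= eps &
    no_multiple_orbit T (a * a).+1 eta g del].
Proof.
move=> d0 hd a0 k0 kd hh eps0 eta0.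
have [[p _]|noX] := pselect (exists p : X, True); last first.
  exists h, 1; split=> // [x|xs]; first by case: noX; exists x.
  by case: noX; exists (xs ord0).
have [[q [i [i0 Tq]]]|free] := pselect (exists (q : X) (i : int), 0 < i /\ T q i = q).
  have [j ej] : exists j : nat, i = j%:Z by exists `|i|%N; lia.
  subst i; have [s hs] := minimal_periodic_finite minT i0 Tq.
  by apply: (perturbation_finite T hs) => //; rewrite ltnS muln_gt0 a0.
apply: (perturbation_free cX p (d := d)) => // x i i0 Tx.
by apply: free; exists x, i.
Qed.

Variables (k r : nat).
Implicit Types g h : X -> 'I_k -> R.
Hypothesis dense_step : forall h (eps eta : R), cube_valued h -> 0 < eps -> 0 < eta ->
  exists g del, [/\ 0 < del, cube_valued g, forall x j, `|g x j - h x j| <= eps &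
    no_multiple_orbit T r eta g del].

(** Both values move by at most [del / 2], so a gap above [2 * del] stays above [del]. *)
Lemma no_multiple_orbit_near eta g g' (del : R) :
  (forall x j, `|g x j - g' x j| <= del / 2) ->
  no_multiple_orbit T r eta g del -> no_multiple_orbit T r eta g' (del / 2).
Proof.
move=> gg' hg xs /hg[l [l' [z [j lt]]]]; exists l, l', z, j.
have h1 := gg' (T (xs l) z) j; have h2 := gg' (T (xs l') z) j.
set u := g (T (xs l) z) j in lt h1; set u' := g' (T (xs l) z) j in h1 *.
set t := g (T (xs l') z) j in lt h2; set t' := g' (T (xs l') z) j in h2 *.
have h3 := ler_normD (u - u') (u' - t'); have h4 := ler_normD (u - t') (t' - t).
rewrite (_ : u - u' + (u' - t') = u - t') in h3; last by ring.
rewrite (_ : u - t' + (t' - t) = u - t) in h4; last by ring.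
rewrite (distrC t' t) in h4; lra.
Qed.

(** Baire's argument with nested closed balls of center [G n] and radius [D n]: each lies in the set
    required at its stage, and the radii tend to 0. *)
Lemma baire_limit h (eps : R) : cube_valued h -> 0 < eps ->
  exists g, [/\ cube_valued g, forall x j, `|g x j - h x j| <= eps &
    forall m : nat, exists2 del : R, 0 < del & no_multiple_orbit T r (m.+1%:R^-1) g del].
Proof.
move=> ch eps0.
pose state := {s : (X -> 'I_k -> R) * R | cube_valued s.1 /\ 0 < s.2}.
(* The first condition nests the balls; the third makes the whole new ball accessible to
   [no_multiple_orbit_near]. *)
have step (m : nat) (s : state) : exists s' : state,
    [/\ forall x j, `|(sval s').1 x j - (sval s).1 x j| <= (sval s).2 - (sval s').2,
        (sval s').2 <= (sval s).2 / 2 &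
        exists2 del, (sval s').2 <= del / 2 & no_multiple_orbit T r (m.+1%:R^-1) (sval s').1 del].
  case: s => -[g d] /= [cg d0].
  have d2 : 0 < d / 2 by rewrite divr_gt0.
  have m0 : 0 < m.+1%:R^-1 :> R by rewrite invr_gt0.
  have [g' [del [del0 cg' gg' hg']]] := dense_step cg d2 m0.
  pose d' := Num.min (del / 2) (d / 2).
  have d'0 : 0 < d' by rewrite lt_min d2 andbT divr_gt0.
  have le1 : d' <= d / 2 by rewrite ge_min lexx orbT.
  have le2 : d' <= del / 2 by rewrite ge_min lexx.
  exists (exist _ (g', d') (conj cg' d'0)) => /=; split=> //; last by exists del.
  by move=> x j; apply: le_trans (gg' x j) _; lra.
have [F hF] := choice (fun ms : nat * state => step ms.1 ms.2).
pose s0 : state := exist _ (h, eps) (conj ch eps0).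
pose s := fix s n := if n is m.+1 then F (m, s m) else s0.
pose G n := (sval (s n)).1; pose D n := (sval (s n)).2.
have cG n : cube_valued (G n) by case: (svalP (s n)).
have D0 n : 0 < D n by case: (svalP (s n)).
have GS n x j : `|G n.+1 x j - G n x j| <= D n - D n.+1 by have [+ _ _] := hF (n, s n); exact.
have DS n : D n.+1 <= D n / 2 by have [_ + _] := hF (n, s n).
have GG n m x j : `|G (n + m)%N x j - G n x j| <= D n - D (n + m)%N.
  elim: m => [|m IH]; first by rewrite addn0 !subrr normr0.
  rewrite addnS; have := ler_normD (G (n + m).+1 x j - G (n + m)%N x j) (G (n + m)%N x j - G n x j).
  have := GS (n + m)%N x j; rewrite (_ : _ - _ + (_ - _) = G (n + m).+1 x j - G n x j); last ring.
  lra.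
have lower n m x j : G n x j - D n <= G m x j + D m.
  have [le|/ltnW le] := leqP n m.
    have := GG n (m - n)%N x j; rewrite subnKC// ler_norml => /andP[? ?].
    have := D0 m; lra.
  have := GG m (n - m)%N x j; rewrite subnKC// ler_norml => /andP[? ?].
  have := D0 n; lra.
(* All lower bounds [G n - D n] lie below all upper bounds [G m + D m], so their supremum is within
   [D n] of every [G n]. *)
pose g x j := sup (range (fun n => G n x j - D n)).
have gG n x j : `|g x j - G n x j| <= D n.
  have hs : has_sup (range (fun n => G n x j - D n)).
    split; first by exists (G 0%N x j - D 0%N), 0%N.
    by exists (G 0%N x j + D 0%N) => _ [m _ <-].
  have h1 : G n x j - D n <= g x j by apply: ub_le_sup; [exact: hs.2|exists n].
  have h2 : g x j <= G n x j + D n by apply: ge_sup; [exact: hs.1|move=> _ [m _ <-]].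
  by rewrite ler_norml; apply/andP; split; lra.
have small e : 0 < e -> exists n, D n < e.
  move=> e0; have Dn n : D n * n.+1%:R <= D 0%N * 1.
    elim: n => [|n IH]; first by [].
    apply: le_trans IH; apply: (@le_trans _ _ (D n / 2 * n.+2%:R)).
      by rewrite ler_wpM2r.
    have := D0 n; rewrite -[n.+2%:R]natr1 -[n.+1%:R]natr1 => Dn0.
    have : 0 <= D n * n%:R by rewrite mulr_ge0// ltW.
    lra.
  exists (Num.truncn (D 0%N / e)).
  have /andP[_ lt] := truncn_itv (divr_ge0 (ltW (D0 0%N)) (ltW e0)).
  move: lt; rewrite ltr_pdivrMr// => lt.
  have := Dn (Num.truncn (D 0%N / e)); rewrite mulr1 => le.
  have := le_lt_trans le lt; rewrite mulrC ltr_pM2l//.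
exists g; split.
- split=> [j|x j].
    apply/continuous_mdistP => x e e0.
    have e3 : 0 < e / 3 by rewrite divr_gt0.
    have [n Dn] := small _ e3.
    have [/(_ j)/continuous_mdistP/(_ x _ e3)[del del0 hdel] _] := cG n.
    exists del => // y /hdel Gxy.
    have := gG n x j; have := gG n y j; rewrite distrC => g1 g2.
    have t1 := ler_normD (g x j - G n x j) (G n x j - G n y j).
    have t2 := ler_normD (g x j - G n y j) (G n y j - g y j).
    rewrite (_ : _ - _ + (_ - _) = g x j - G n y j) in t1; last ring.
    rewrite (_ : _ - _ + (_ - _) = g x j - g y j) in t2; last ring.
    lra.
  apply/andP; split; rewrite leNgt; apply/negP => lt.
    have e0 : 0 < - g x j by lra.
    have [n Dn] := small _ e0; have [_ /(_ x j)/andP[G0 _]] := cG n.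
    have := gG n x j; rewrite ler_norml => /andP[? ?]; lra.
  have e0 : 0 < g x j - 1 by lra.
  have [n Dn] := small _ e0; have [_ /(_ x j)/andP[_ G1]] := cG n.
  by have := gG n x j; rewrite ler_norml => /andP[? ?]; lra.
- by move=> x j; exact: gG 0%N x j.
move=> m; have [_ _ [del Ddel hdel]] := hF (m, s m).
have Dm := D0 m.+1.
exists (del / 2); first exact: lt_le_trans Dm Ddel.
apply: no_multiple_orbit_near hdel => x j; rewrite distrC.
exact: le_trans (gG m.+1 x j) Ddel.
Qed.

End Baire.

(** * The space of continuous maps into the cube *)

Section Transfer.
Context {R : realType} {X : metricType R} (k : nat).
Notation CX := (cfun_space X (cube R k)).

Definition coord (f : CX) (x : X) (j : 'I_k) : R :=
  set_val ((f : continuousType X (cube R k)) x) ord0 j.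

Lemma cfun_nbhsP (f : CX) (S : set CX) :
  nbhs f S <-> exists2 e : R, 0 < e &
    forall f', (forall x j, `|coord f x j - coord f' x j| < e) -> S f'.
Proof.
split.
  rewrite -nbhs_entourageE => -[E [E' [B entB BE'] E'E] ES].
  move: entB; rewrite -entourage_ballE => -[e /= e0 eB].
  exists e => // f' close; apply: ES; apply/mem_set/E'E/BE' => x; apply: eB => /=.
  by split=> // i j; rewrite ord1; exact: close.
move=> [e e0 eS]; rewrite -nbhs_entourageE.
pose B := [set uv : cube R k * cube R k | ball uv.1 e uv.2].
exists [set fg : CX * CX | forall x, B ((fg.1 : continuousType X (cube R k)) x,
    (fg.2 : continuousType X (cube R k)) x)].
  exists [set fg | forall x, B (fg.1 x, fg.2 x)] => //.
  exists B => //; rewrite -entourage_ballE; exists e => //.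
move=> f' /set_mem /= close; apply: eS => x j.
by have [_] := close x; apply.
Qed.

Lemma coord_cube_valued (f : CX) : cube_valued (coord f).
Proof.
split=> [j x|x j].
  apply: (@continuous_comp _ _ _ (f : continuousType X (cube R k)) (fun v => set_val v ord0 j)).
    exact: cts_fun.
  apply: (@continuous_comp _ _ _ (@set_val _ (cube R k)) (fun v : 'rV[R]_k => v ord0 j)).
    exact: initial_continuous.
  exact: coord_continuous.
exact: (set_valP ((f : continuousType X (cube R k)) x)).
Qed.

Lemma coord_surjective (h : X -> 'I_k -> R) : cube_valued h ->
  exists f : CX, forall x j, coord f x j = h x j.
Proof.
move=> [ch h01].
have hc x : (\row_j h x j) \in cube R k by apply/mem_set => j; rewrite mxE.
pose f x : cube R k := exist _ (\row_j h x j) (hc x).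
have cf : continuous f.
  move=> x; apply/cvg_ballP => e e0.
  have : \forall y \near x, forall j, `|h x j - h y j| < e.
    by apply: filter_forall => j; have /cvgrPdist_lt/(_ e e0) := ch j x.
  apply: filterS => y hy; split=> // i j; rewrite !mxE; exact: hy.
pose F : continuousType X (cube R k) := HB.pack f (isContinuous.Build _ _ f cf).
by exists F => x j; rewrite /coord /= mxE.
Qed.

Lemma open_cfun (S : set CX) :
  (forall f, S f -> exists2 e : R, 0 < e &
     forall f', (forall x j, `|coord f x j - coord f' x j| < e) -> S f') -> open S.
Proof. by move=> hS; rewrite openE => f /hS; rewrite /interior => /cfun_nbhsP. Qed.

End Transfer.

(** * From separated tuples to the size of fibers *)

Lemma injection_of_fset (X : choiceType) (a : nat) (B : {fset X}) : (a < #|` B|)%N ->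
  exists2 xs : 'I_a.+1 -> X, injective xs & forall l, xs l \in B.
Proof.
rewrite cardfE -cardsT => /injection_of_card[phi injphi _].
by exists (fun l => val (phi l)) => [l l' /val_inj/injphi|l]; [|exact: valP].
Qed.

Lemma separation_of_injective {R : realType} (X : metricType R) (r : nat) (xs : 'I_r -> X) :
  injective xs ->
  exists m : nat, forall l l', l != l' -> m.+1%:R^-1 <= mdist (xs l) (xs l').
Proof.
move=> inj; pose e := \big[Num.min/1]_(p : 'I_r * 'I_r | p.1 != p.2) mdist (xs p.1) (xs p.2).
have e0 : 0 < e.
  apply/bigmin_gtP; split=> // p np; rewrite mdist_gt0.
  by apply: contra np => /eqP/inj->.
exists (Num.truncn e^-1) => l l' ll'.
have /andP[_ lt] : (Num.truncn e^-1)%:R <= e^-1 < (Num.truncn e^-1).+1%:R.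
  by apply: truncn_itv; rewrite invr_ge0 ltW.
apply: (@le_trans _ _ e); last exact: (@bigmin_le_cond _ _ _ _ (l, l')).
by rewrite -[leRHS]invrK lef_pV2 ?posrE ?invr_gt0// ltW.
Qed.

(** An infinite set would contain a finite subset with [a + 1] elements, which the hypothesis
    excludes. *)
Lemma at_most_of_separated {R : realType} (X : choiceType) (S : set X) (a : nat) (c : R) :
  (forall xs : 'I_a.+1 -> X, injective xs -> (forall l, S (xs l)) -> False) ->
  a%:R <= c -> at_most S c.
Proof.
move=> hS ac.
have few (B : {fset X}) : [set` B] `<=` S -> (#|` B| <= a)%N.
  move=> BS; rewrite leqNgt; apply/negP => /injection_of_fset[xs inj xsB].
  by apply: (hS xs) => // l; apply: BS; exact: xsB.
have finS : finite_set S.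
  apply: contrapT => /(infinite_set_fset a.+1)[B BS].
  by rewrite ltnNge few.
split=> //; apply: le_trans ac; rewrite ler_nat; apply: few => x /=.
by rewrite in_fset_set// => /set_mem.
Qed.

Lemma mdim_lt {R : realType} {X : metricType R} (T : int_action X) (d d1 : R) :
  mdim T = d%:E -> d < d1 -> exists d', [/\ 0 < d', d' < d1 & mdim_le_minus T d'].
Proof.
move=> md lt; have /ereal_inf_lt[_ [d' [d'0 hd'] <-]] : (mdim T < d1%:E)%E by rewrite md lte_fin.
by rewrite lte_fin => lt'; exists d'.
Qed.

Lemma mdim_ge0 {R : realType} {X : metricType R} (T : int_action X) : (0 <= mdim T)%E.
Proof. by apply: le_ereal_inf_tmp => _ [d [d0 _] <-]; rewrite lee_fin ltW. Qed.

Theorem theorem1p1 (R : realType) (X : metricType R) (T : int_action X)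
  (d : R) (k : nat) :
  compact [set: X] -> minimal T -> mdim T = d%:E -> d < k%:R ->
  almost_every
    (fun f : cfun_space X (cube R k) =>
       forall y : int -> cube R k,
         at_most (orbit_map T (f : continuousType X (cube R k)) @^-1` [set y])
           ((Num.floor (k%:R / (k%:R - d)))%:~R * (k%:R / (k%:R - d)))).
Proof.
move=> cX minT md dk.
have d0 : 0 <= d by rewrite -lee_fin -md mdim_ge0.
have kd0 : 0 < k%:R - d by rewrite subr_gt0.
have k0 : (0 < k)%N by rewrite -(ltr0n R); apply: le_lt_trans dk.
set q := k%:R / (k%:R - d).
have q1 : 1 <= q by rewrite ler_pdivlMr// mul1r gerBl.
have /andP[flq qfl] := floor_itv q.
have fl1 : 1 <= Num.floor q by rewrite floor_ge_int.
have [a ea] : exists a : nat, Num.floor q = a%:Z by exists `|Num.floor q|%N; lia.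
rewrite ea in flq qfl fl1 *.
have a0 : (0 < a)%N by lia.
have ka : k%:R < a.+1%:R * (k%:R - d).
  by rewrite -ltr_pdivrMr// -/q -[a.+1]addn1 natrD; move: qfl; rewrite intrD.
(* The strict inequality leaves room: every [d'] below [k - k / (a + 1)], a number exceeding [d],
   satisfies it, and the infimum provides a positive one also when [d = 0]. *)
have [d' [d'0 hd' kd']] : exists d', [/\ 0 < d', mdim_le_minus T d' & k%:R < a.+1%:R * (k%:R - d')].
  pose d1 := k%:R - k%:R / a.+1%:R : R.
  have a1 : 0 < a.+1%:R :> R by [].
  have dd1 : d < d1 by rewrite /d1 ltrBrDr -ltrBrDl ltr_pdivrMr// mulrC.
  have [d' [d'0 lt hd']] := mdim_lt md dd1; exists d'; split=> //.
  by rewrite mulrC -ltr_pdivrMr// ltrBrDr addrC -ltrBrDr.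
have dense_step (h : X -> 'I_k -> R) (eps eta : R) :=
  @perturbation R X T cX minT d' k a h eps eta d'0 hd' a0 k0 kd'.
pose r := (a * a).+1.
(* Openness holds at each scale [1 / (m + 1)], and [baire_limit] gives density of the intersection
   directly. Finitely many distinct points are separated at some scale. *)
pose O m := [set f : cfun_space X (cube R k) |
  exists2 del : R, 0 < del & no_multiple_orbit T r (m.+1%:R^-1) (coord f) del].
exists (\bigcap_m O m); first split.
- exists O => // m; apply: open_cfun => f [del del0 hdel].
  have del2 : 0 < del / 2 by rewrite divr_gt0.
  exists (del / 2) => // f' close; exists (del / 2) => //.
  by apply: no_multiple_orbit_near hdel => x j; exact: ltW.
- move=> U [f Uf] oU.
  have /cfun_nbhsP[e e0 eU] : nbhs f U by exact: open_nbhs_nbhs.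
  have e2 : 0 < e / 2 by rewrite divr_gt0.
  have [g [cg gf hg]] := baire_limit dense_step (coord_cube_valued f) e2.
  have [f' ff'] := coord_surjective cg.
  exists f'; split.
    by apply: eU => x j; rewrite ff' distrC; apply: le_lt_trans (gf x j) _; lra.
  move=> m _; have [del del0 hdel] := hg m; exists del => //.
  by move=> xs /hdel[l [l' [z [j lt]]]]; exists l, l', z, j; rewrite !ff'.
move=> f Of y; apply: (@at_most_of_separated _ _ _ (a * a)).
  move=> xs inj xsy; have [m sep] := separation_of_injective inj.
  have [del del0 /(_ xs sep)[l [l' [z [j]]]]] := Of m I.
  have := congr1 (@^~ z) (etrans (xsy l) (esym (xsy l'))).
  rewrite /orbit_map /coord => ->; rewrite subrr normr0.
  by rewrite ltNge mulr_ge0// ltW.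
(* Since [a <= q], the count [a * a] is at most [a * q]. *)
by rewrite natrM ler_wpM2l.
Qed.
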